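(* Let $0<k_1<\cdots<k_m<n$ be integers, let $a_1,\dots,a_m$ be positive integers, and put $\mathbf k=(k_1,\dots,k_m)$, $\mathbf l=(l_1,\dots,l_m)=(n-k_m,\dots,n-k_1)$, $\mathbf a=(a_1,\dots,a_m)$, $\mathbf b=(b_1,\dots,b_m)=(a_m,\dots,a_1)$, $|\mathbf a|=\sum_i a_i$, $\mathbf\Lambda=(|\mathbf a|,\dots,|\mathbf a|)\in\mathbb Z^n$. Let $\mathbf r$ be an $n$-tuple of positive integers with $\sum_i r_i=\sum_i a_ik_i$, and $\mathbf s=\mathbf\Lambda-\mathbf r$. Then: (1) The map $\widetilde\Psi$ induces an isomorphism of graded rings $$\bigoplus_{N=0}^\infty\Gamma\big(F_{\mathbf k}(\mathbb C^n),\mathcal L_{\mathbf k}^{N\mathbf a}(N\mathbf r)\big)^H\cong\bigoplus_{N=0}^\infty\Gamma\big(F_{\mathbf l}(\mathbb C^n),\mathcal L_{\mathbf l}^{N\mathbf b}(N\mathbf s)\big)^H.$$ (2) Equivalently, $\widetilde\Psi$ induces an isomorphism of Mumford quotients $F_{\mathbf k}(\mathbb C^n)/\!/_{\mathbf r}H\cong F_{\mathbf l}(\mathbb C^n)/\!/_{\mathbf s}H$.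
   Context: $F_{\mathbf k}(\mathbb C^n)$ is the manifold of flags $V_1\subset\cdots\subset V_m\subset\mathbb C^n$, $\dim V_i=k_i$. $H\subset GL_n(\mathbb C)$ is the group of invertible diagonal matrices. $\mathcal L_{\mathbf k}^{\mathbf a}$ is the homogeneous line bundle whose isotropy character is the inverse of the dominant weight $\sum_i a_i\varpi_{k_i}$, i.e. with fibre $\bigotimes_i(\bigwedge^{k_i}V_i^* )^{\otimes a_i}$ at $(V_1,\dots,V_m)$, with the natural $GL_n(\mathbb C)$-action. For $\mathbf t\in\mathbb Z^n$, $\mathcal L(\mathbf t)$ is $\mathcal L$ with its $H$-action multiplied by the character $\chi_{\mathbf t}(\mathrm{diag}(z_i))=\prod z_i^{t_i}$; $H$ acts on sections by $(h\cdot s)(x)=h\cdot s(h^{-1}x)$. The Mumford quotient $F_{\mathbf k}(\mathbb C^n)/\!/_{\mathbf r}H$ is the GIT quotient for the linearized bundle $\mathcal L_{\mathbf k}^{\mathbf a}(\mathbf r)$ (and similarly $F_{\mathbf l}(\mathbb C^n)/\!/_{\mathbf s}H$ for $\mathcal L_{\mathbf l}^{\mathbf b}(\mathbf s)$), i.e. $\mathrm{Proj}$ of the displayed ring. $B$ is the symmetric complex bilinear form on $\mathbb C^n$ with orthonormal standard basis; $\Psi(V_1\subset\cdots\subset V_m)=(V_m^\perp\subset\cdots\subset V_1^\perp)$ ($B$-orthogonal complements). Let $\theta_1,\dots,\theta_n$ be the dual of the standard basis and $\ast:\bigwedge^k((\mathbb C^n)^* )\to\bigwedge^{n-k}((\mathbb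 C^n)^* )$ the complex Hodge star for $B$ and $vol=\theta_1\wedge\cdots\wedge\theta_n$: $\ast\theta_I=\mathrm{sgn}(I,J)\theta_J$, with $J$ the complement of $I$ and $\mathrm{sgn}(I,J)$ the sign of the permutation listing $I$ then $J$ increasingly. For each subspace $x$ of dimension $k$ there is a well-defined isomorphism $\bigwedge^k(x^* )\to\bigwedge^{n-k}((x^\perp)^* )$, $\mathrm{res}_x(\tau)\mapsto\mathrm{res}_{x^\perp}(\ast\tau)$, where $\mathrm{res}$ is restriction of forms. $\hat\Psi:\mathcal L_{\mathbf k}^{N\mathbf a}\to\mathcal L_{\mathbf l}^{N\mathbf b}$ is the bundle isomorphism covering $\Psi$ given by the tensor product of these isomorphisms (for $x=V_1,\dots,V_m$) followed by reversal of the order of the tensor factors, and $\widetilde\Psi(s)(x)=\hat\Psi(s(\Psi^{-1}(x)))$ on sections. *)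

(* Defs.v *)
From HB Require Import structures.
From mathcomp Require Import fingroup perm.
From mathcomp Require Import all_boot all_order all_algebra.
From mathcomp Require Import ring.
From mathcomp Require Import complex.
From mathcomp Require Import boolp classical_sets functions reals topology.
From mathcomp Require Import normedtype derive.

Set Implicit Arguments.
Unset Strict Implicit.
Unset Printing Implicit Defensive.

Import Order.TTheory GRing.Theory Num.Theory numFieldNormedType.Exports.
Local Open Scope classical_set_scope.
Local Open Scope ring_scope.
Local Open Scope quotient_scope.

Record gradedAlg (K : comPzRingType) := GradedAlg {
  gaRing :> comPzRingType;
  gaConst : {rmorphism K -> gaRing};
  piece : nat -> set gaRing;
  piece0 : forall N, piece N 0;
  pieceB : forall N f g, piece N f -> piece N g -> piece N (f - g);
  pieceM : forall M N f g, piece M f -> piece N g -> piece (M + N)%N (f * g);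
  piece_const : forall c, piece 0%N (gaConst c);
  piece_sum : forall f, exists (d : nat) (h : nat -> gaRing),
    (forall N, piece N (h N)) /\ f = \sum_(N < d) h N;
  piece_direct : forall (d : nat) (h : nat -> gaRing),
    (forall N, piece N (h N)) -> \sum_(N < d) h N = 0 ->
    forall N, (N < d)%N -> h N = 0 }.

Arguments piece {K} _ _ _.
Arguments gaConst {K} _.

Section ProjDef.
Variables (K : comPzRingType) (A : gradedAlg K).

Lemma piece1 : piece A 0%N 1.
Proof. by rewrite -(rmorph1 (gaConst A)); apply: piece_const. Qed.

Lemma pieceD N (f g : A) : piece A N f -> piece A N g -> piece A N (f + g).
Proof.
move=> hf hg; rewrite -[g]opprK; apply: pieceB => //.
by rewrite -sub0r; apply: pieceB => //; apply: piece0.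
Qed.

Lemma pieceN N (f : A) : piece A N f -> piece A N (- f).
Proof. by move=> hf; rewrite -sub0r; apply: pieceB => //; apply: piece0. Qed.

(* Homogeneous prime ideals that do not contain the irrelevant ideal. *)
Record proj_point := ProjPoint {
  pideal :> A -> Prop;
  pideal0 : pideal 0;
  pidealD : forall f g, pideal f -> pideal g -> pideal (f + g);
  pidealM : forall f g, pideal g -> pideal (f * g);
  pideal_homogeneous : forall f, pideal f -> exists (d : nat) (h : nat -> A),
    (forall N, piece A N (h N) /\ pideal (h N)) /\ f = \sum_(N < d) h N;
  pideal_proper : ~ pideal 1;
  pideal_prime : forall f g, pideal (f * g) -> pideal f \/ pideal g;
  pideal_relevant : exists N (f : A), [/\ (0 < N)%N, piece A N f & ~ pideal f] }.

HB.instance Definition _ := gen_eqMixin proj_point.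
HB.instance Definition _ := gen_choiceMixin proj_point.

Definition zariski_open (U : set proj_point) := exists S : set A,
  (forall f, S f -> exists N, piece A N f) /\
  (forall P : proj_point, U P <-> ~ (S `<=` pideal P)).

Lemma zariski_openT : zariski_open [set: proj_point].
Proof.
exists [set 1]; split=> [f ->|P]; first by exists 0%N; apply: piece1.
by split=> // _ h; case: (pideal_proper (h 1 erefl)).
Qed.

Lemma zariski_openI U V :
  zariski_open U -> zariski_open V -> zariski_open (U `&` V).
Proof.
move=> [S [hS eU]] [T [hT eV]].
exists [set fg | exists f g, [/\ S f, T g & fg = f * g]]; split.
  move=> _ [f [g [/hS[N fN] /hT[M gM] ->]]].
  by exists (N + M)%N; apply: pieceM.
move=> P; split=> [[/eU nS /eV nT] h|h].
  have /existsNP[f /not_implyP[Sf nf]] := nS.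
  have /existsNP[g /not_implyP[Tg ng]] := nT.
  by case: (@pideal_prime P f g (h _ _)) => //; exists f, g.
split; [apply/eU|apply/eV] => sub; apply: h => _ [f [g [Sf Tg ->]]].
  by rewrite mulrC; apply/pidealM/sub.
exact/pidealM/sub.
Qed.

Lemma zariski_open_bigU (I : Type) (F : I -> set proj_point) :
  (forall i, zariski_open (F i)) -> zariski_open (\bigcup_i F i).
Proof.
move=> oF; have /choice[S hS] := oF.
exists (\bigcup_i S i); split=> [f [i _ Sf]|P]; first exact: (hS i).1 Sf.
split=> [[i _ /(hS i).2 n] h|]; first by apply: n => f Sf; apply: h; exists i.
move=> /existsNP[f /not_implyP[[i _ Sf] nf]].
by exists i => //; apply/(hS i).2 => /(_ _ Sf).
Qed.

HB.instance Definition _ := isOpenTopological.Build proj_point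
  zariski_openT zariski_openI zariski_open_bigU.

Section Localization.
Variable P : proj_point.

Record hfrac := HFrac {
  hdeg : nat;
  hnum : A;
  hden : A;
  hnum_deg : piece A hdeg hnum;
  hden_deg : piece A hdeg hden;
  hden_notin : ~ P hden }.

HB.instance Definition _ := gen_eqMixin hfrac.
HB.instance Definition _ := gen_choiceMixin hfrac.

Definition hfrac_eq (x y : hfrac) : bool := `[< exists N h,
  [/\ piece A N h, ~ P h & h * (hnum x * hden y - hnum y * hden x) = 0] >].

Lemma notin_mul (f g : A) : ~ P f -> ~ P g -> ~ P (f * g).
Proof. by move=> nf ng /pideal_prime[]. Qed.

Lemma hfrac_eq_refl : reflexive hfrac_eq.
Proof.
move=> x; apply/asboolP; exists 0%N, 1.
by split; [apply: piece1|apply: pideal_proper|rewrite subrr mulr0].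
Qed.

Lemma hfrac_eq_sym : symmetric hfrac_eq.
Proof.
move=> x y; apply/asboolP/asboolP=> -[N [h [hN nh e]]]; exists N, h;
  by split=> //; rewrite -opprB mulrN e oppr0.
Qed.

Lemma hfrac_eq_trans : transitive hfrac_eq.
Proof.
move=> y x z /asboolP[N [h [hN nh e]]] /asboolP[M [g [gM ng e']]].
apply/asboolP; exists (N + M + hdeg y)%N, (h * g * hden y); split.
- by do !apply: pieceM => //; apply: hden_deg.
- by do !apply: notin_mul => //; apply: hden_notin.
have -> : h * g * hden y * (hnum x * hden z - hnum z * hden x) =
  g * hden z * (h * (hnum x * hden y - hnum y * hden x)) +
  h * hden x * (g * (hnum y * hden z - hnum z * hden y)) by ring.
by rewrite e e' !mulr0 addr0.
Qed.

Canonical hfrac_equiv := EquivRel hfrac_eq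
  hfrac_eq_refl hfrac_eq_sym hfrac_eq_trans.

(* The degree zero part of the localization of A at the homogeneous elements
   outside P. *)
Definition hloc := {eq_quot hfrac_eq}.
HB.instance Definition _ := Choice.on hloc.
HB.instance Definition _ : EqQuotient _ hfrac_eq hloc := EqQuotient.on hloc.

Lemma hlocP (x y : hfrac) : (exists N h,
    [/\ piece A N h, ~ P h & h * (hnum x * hden y - hnum y * hden x) = 0]) ->
  \pi_hloc x = \pi_hloc y.
Proof. by move=> h; apply/eqmodP/asboolP. Qed.

Lemma hloc_eqP (x y : hfrac) : \pi_hloc x = \pi_hloc y -> exists N h,
  [/\ piece A N h, ~ P h & h * (hnum x * hden y - hnum y * hden x) = 0].
Proof. by move/eqmodP/asboolP. Qed.

Lemma hlocP1 (x y : hfrac) :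
  hnum x * hden y = hnum y * hden x -> \pi_hloc x = \pi_hloc y.
Proof.
move=> e; apply: hlocP; exists 0%N, 1.
by split; [apply: piece1|apply: pideal_proper|rewrite e subrr mulr0].
Qed.

Definition hfrac0 : hfrac := HFrac (piece0 A 0) piece1 (@pideal_proper P).
Definition hfrac1 : hfrac := HFrac piece1 piece1 (@pideal_proper P).
Definition hfracN (x : hfrac) : hfrac :=
  HFrac (pieceN (hnum_deg x)) (hden_deg x) (@hden_notin x).
Definition hfracD (x y : hfrac) : hfrac := HFrac
  (pieceD (pieceM (hnum_deg x) (hden_deg y)) (pieceM (hden_deg x) (hnum_deg y)))
  (pieceM (hden_deg x) (hden_deg y)) (notin_mul (@hden_notin x) (@hden_notin y)).
Definition hfracM (x y : hfrac) : hfrac := HFrac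
  (pieceM (hnum_deg x) (hnum_deg y))
  (pieceM (hden_deg x) (hden_deg y)) (notin_mul (@hden_notin x) (@hden_notin y)).

Definition hloc0 : hloc := \pi_hloc hfrac0.
Definition hloc1 : hloc := \pi_hloc hfrac1.
Definition hlocN (x : hloc) : hloc := \pi_hloc (hfracN (repr x)).
Definition hlocD (x y : hloc) : hloc := \pi_hloc (hfracD (repr x) (repr y)).
Definition hlocM (x y : hloc) : hloc := \pi_hloc (hfracM (repr x) (repr y)).

Lemma hlocN_pi x : hlocN (\pi_hloc x) = \pi_hloc (hfracN x).
Proof.
rewrite /hlocN; have /hloc_eqP[N [h [hN nh e]]] := reprK (\pi_hloc x).
apply: hlocP; exists N, h; split=> //=; move: e; case: (repr _) => ? a b ? ? ?.
by case: x => ? c d ? ? ? /= e; rewrite !mulNr -opprD mulrN e oppr0.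
Qed.

Lemma hlocD_pi x y : hlocD (\pi_hloc x) (\pi_hloc y) = \pi_hloc (hfracD x y).
Proof.
rewrite /hlocD; have /hloc_eqP[N [h [hN nh e]]] := reprK (\pi_hloc x).
have /hloc_eqP[M [g [gM ng e']]] := reprK (\pi_hloc y).
apply: hlocP; exists (N + M)%N, (h * g); split=> //=.
- exact: pieceM.
- exact: notin_mul.
move: e e'; set x' := repr _; set y' := repr _ => e e'.
have -> : h * g * ((hnum x' * hden y' + hden x' * hnum y') * (hden x * hden y) -
  (hnum x * hden y + hden x * hnum y) * (hden x' * hden y')) =
  g * hden y * hden y' * (h * (hnum x' * hden x - hnum x * hden x')) +
  h * hden x * hden x' * (g * (hnum y' * hden y - hnum y * hden y')) by ring.
by rewrite e e' !mulr0 addr0.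
Qed.

Lemma hlocM_pi x y : hlocM (\pi_hloc x) (\pi_hloc y) = \pi_hloc (hfracM x y).
Proof.
rewrite /hlocM; have /hloc_eqP[N [h [hN nh e]]] := reprK (\pi_hloc x).
have /hloc_eqP[M [g [gM ng e']]] := reprK (\pi_hloc y).
apply: hlocP; exists (N + M)%N, (h * g); split=> //=.
- exact: pieceM.
- exact: notin_mul.
move: e e'; set x' := repr _; set y' := repr _ => e e'.
have -> : h * g * (hnum x' * hnum y' * (hden x * hden y) -
  hnum x * hnum y * (hden x' * hden y')) =
  g * hnum y' * hden y * (h * (hnum x' * hden x - hnum x * hden x')) +
  h * hnum x * hden x' * (g * (hnum y' * hden y - hnum y * hden y')) by ring.
by rewrite e e' !mulr0 addr0.
Qed.

Lemma hlocDA : associative hlocD.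
Proof.
elim/quotW=> x; elim/quotW=> y; elim/quotW=> z.
rewrite (hlocD_pi y z) (hlocD_pi x y) (hlocD_pi _ z) (hlocD_pi x).
by apply: hlocP1 => /=; ring.
Qed.

Lemma hlocDC : commutative hlocD.
Proof.
elim/quotW=> x; elim/quotW=> y; rewrite (hlocD_pi x y) (hlocD_pi y x).
by apply: hlocP1 => /=; ring.
Qed.

Lemma hloc0D : left_id hloc0 hlocD.
Proof.
by elim/quotW=> x; rewrite (hlocD_pi hfrac0 x); apply: hlocP1 => /=; ring.
Qed.

Lemma hlocND : left_inverse hloc0 hlocN hlocD.
Proof.
elim/quotW=> x; rewrite (hlocN_pi x) (hlocD_pi _ x).
by apply: hlocP1 => /=; ring.
Qed.

HB.instance Definition _ := GRing.isZmodule.Build hloc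
  hlocDA hlocDC hloc0D hlocND.

Lemma hlocMA : associative hlocM.
Proof.
elim/quotW=> x; elim/quotW=> y; elim/quotW=> z.
rewrite (hlocM_pi y z) (hlocM_pi x y) (hlocM_pi _ z) (hlocM_pi x).
by apply: hlocP1 => /=; ring.
Qed.

Lemma hlocMC : commutative hlocM.
Proof.
elim/quotW=> x; elim/quotW=> y; rewrite (hlocM_pi x y) (hlocM_pi y x).
by apply: hlocP1 => /=; ring.
Qed.

Lemma hloc1M : left_id hloc1 hlocM.
Proof.
by elim/quotW=> x; rewrite (hlocM_pi hfrac1 x); apply: hlocP1 => /=; ring.
Qed.

Lemma hlocMD : left_distributive hlocM hlocD.
Proof.
elim/quotW=> x; elim/quotW=> y; elim/quotW=> z.
rewrite (hlocD_pi x y) (hlocM_pi _ z) (hlocM_pi x z) (hlocM_pi y z) hlocD_pi.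
by apply: hlocP1 => /=; ring.
Qed.

HB.instance Definition _ := GRing.Zmodule_isComPzRing.Build hloc
  hlocMA hlocMC hloc1M hlocMD.

End Localization.

Section Sheaf.
Variable U : set proj_point.

(* For open U this is the usual condition; U is not required to be open here. *)
Definition locally_fraction (s : forall P, U P -> hloc P) :=
  forall P, U P -> exists V : set proj_point, [/\ open V, V P &
    exists N f g (fN : piece A N f) (gN : piece A N g),
      forall Q (UQ : U Q), V Q -> exists ng : ~ Q g,
        s Q UQ = \pi_(hloc Q) (HFrac fN gN ng)].

Record ringSections := RingSection {
  rsval :> forall P, U P -> hloc P;
  rsvalP : locally_fraction rsval }.

Lemma ringSection_eq (s t : ringSections) :
  (forall P UP, s P UP = t P UP) -> s = t.
Proof.
case: s t => [s hs] [t ht] /= st.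
have e : s = t.
  by apply: functional_extensionality_dep => P; apply/funext => UP; apply: st.
by rewrite -e in ht *; congr RingSection; apply: Prop_irrelevance.
Qed.

HB.instance Definition _ := gen_eqMixin ringSections.
HB.instance Definition _ := gen_choiceMixin ringSections.

Lemma locally_fraction0 : locally_fraction (fun P _ => 0).
Proof.
move=> P UP; exists setT; split=> //; first exact: openT.
exists 0%N, 0, 1, (piece0 A 0), piece1 => Q UQ _.
by exists (@pideal_proper Q); apply: hlocP1.
Qed.

Lemma locally_fraction1 : locally_fraction (fun P _ => 1).
Proof.
move=> P UP; exists setT; split=> //; first exact: openT.
exists 0%N, 1, 1, piece1, piece1 => Q UQ _.
by exists (@pideal_proper Q); apply: hlocP1.
Qed.

Lemma locally_fractionN (s : ringSections) :
  locally_fraction (fun P UP => - s P UP).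
Proof.
move=> P UP; have [V [oV VP [N [f [g [fN [gN h]]]]]]] := rsvalP s UP.
exists V; split=> //; exists N, (- f), g, (pieceN fN), gN => Q UQ VQ.
by have [ng e] := h Q UQ VQ; exists ng; rewrite e [LHS]hlocN_pi; apply: hlocP1.
Qed.

Lemma locally_fractionD (s t : ringSections) :
  locally_fraction (fun P UP => s P UP + t P UP).
Proof.
move=> P UP; have [V [oV VP [N [f [g [fN [gN h]]]]]]] := rsvalP s UP.
have [V' [oV' VP' [N' [f' [g' [fN' [gN' h']]]]]]] := rsvalP t UP.
exists (V `&` V'); split=> //; first exact: openI.
exists (N + N')%N, (f * g' + g * f'), (g * g').
exists (pieceD (pieceM fN gN') (pieceM gN fN')), (pieceM gN gN') => Q UQ [VQ VQ'].
have [ng e] := h Q UQ VQ; have [ng' e'] := h' Q UQ VQ'.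
by exists (notin_mul ng ng'); rewrite e e' [LHS]hlocD_pi; apply: hlocP1.
Qed.

Lemma locally_fractionM (s t : ringSections) :
  locally_fraction (fun P UP => s P UP * t P UP).
Proof.
move=> P UP; have [V [oV VP [N [f [g [fN [gN h]]]]]]] := rsvalP s UP.
have [V' [oV' VP' [N' [f' [g' [fN' [gN' h']]]]]]] := rsvalP t UP.
exists (V `&` V'); split=> //; first exact: openI.
exists (N + N')%N, (f * f'), (g * g').
exists (pieceM fN fN'), (pieceM gN gN') => Q UQ [VQ VQ'].
have [ng e] := h Q UQ VQ; have [ng' e'] := h' Q UQ VQ'.
by exists (notin_mul ng ng'); rewrite e e' [LHS]hlocM_pi; apply: hlocP1.
Qed.

Definition rs0 := RingSection locally_fraction0.
Definition rs1 := RingSection locally_fraction1.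
Definition rsN s := RingSection (locally_fractionN s).
Definition rsD s t := RingSection (locally_fractionD s t).
Definition rsM s t := RingSection (locally_fractionM s t).

Lemma rsDA : associative rsD.
Proof. by move=> s t u; apply: ringSection_eq => P UP; apply: addrA. Qed.
Lemma rsDC : commutative rsD.
Proof. by move=> s t; apply: ringSection_eq => P UP; apply: addrC. Qed.
Lemma rs0D : left_id rs0 rsD.
Proof. by move=> s; apply: ringSection_eq => P UP; apply: add0r. Qed.
Lemma rsND : left_inverse rs0 rsN rsD.
Proof. by move=> s; apply: ringSection_eq => P UP; apply: addNr. Qed.

HB.instance Definition _ := GRing.isZmodule.Build ringSections
  rsDA rsDC rs0D rsND.

Lemma rsMA : associative rsM.
Proof. by move=> s t u; apply: ringSection_eq => P UP; apply: mulrA. Qed.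
Lemma rsMC : commutative rsM.
Proof. by move=> s t; apply: ringSection_eq => P UP; apply: mulrC. Qed.
Lemma rs1M : left_id rs1 rsM.
Proof. by move=> s; apply: ringSection_eq => P UP; apply: mul1r. Qed.
Lemma rsMD : left_distributive rsM rsD.
Proof. by move=> s t u; apply: ringSection_eq => P UP; apply: mulrDl. Qed.

HB.instance Definition _ := GRing.Zmodule_isComPzRing.Build ringSections
  rsMA rsMC rs1M rsMD.

End Sheaf.

Lemma locally_fraction_restrict (U V : set proj_point) (VU : V `<=` U)
  (s : ringSections U) : locally_fraction (fun P VP => s P (VU P VP)).
Proof.
move=> P VP; have [W [oW WP [N [f [g [fN [gN h]]]]]]] := rsvalP s (VU P VP).
by exists W; split=> //; exists N, f, g, fN, gN => Q VQ; apply: h.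
Qed.

Definition restriction (U V : set proj_point) (VU : V `<=` U) (s : ringSections U) :
  ringSections V := RingSection (locally_fraction_restrict VU s).

Lemma restriction_zmod (U V : set proj_point) (VU : V `<=` U) :
  zmod_morphism (restriction VU).
Proof. by move=> s t; apply: ringSection_eq. Qed.

Lemma restriction_monoid (U V : set proj_point) (VU : V `<=` U) :
  monoid_morphism (restriction VU).
Proof. by split=> [|s t]; apply: ringSection_eq. Qed.

HB.instance Definition _ (U V : set proj_point) (VU : V `<=` U) :=
  GRing.isZmodMorphism.Build (ringSections U) (ringSections V) (restriction VU)
    (restriction_zmod VU).
HB.instance Definition _ (U V : set proj_point) (VU : V `<=` U) :=
  GRing.isMonoidMorphism.Build (ringSections U) (ringSections V) (restriction VU)
    (restriction_monoid VU).

Lemma restriction_comp (U V W : set proj_point) (VU : V `<=` U) (WV : W `<=` V)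
    (WU : W `<=` U) (s : ringSections U) :
  restriction WV (restriction VU s) = restriction WU s.
Proof.
apply: ringSection_eq => P WP /=; congr (rsval s _); exact: Prop_irrelevance.
Qed.

Lemma restriction_local (I : Type) (U : I -> set proj_point) (V : set proj_point)
    (UV : forall i, U i `<=` V) (s t : ringSections V) :
  V = \bigcup_i U i ->
  (forall i, restriction (UV i) s = restriction (UV i) t) -> s = t.
Proof.
move=> eV st; apply: ringSection_eq => P VP.
have [i _ UiP] : (\bigcup_i U i) P by rewrite -eV.
have := congr1 (fun u : ringSections (U i) => u P UiP) (st i).
by rewrite /= (Prop_irrelevance (UV i P UiP) VP).
Qed.

Lemma restriction_glue (I : Type) (U : I -> set proj_point) (V : set proj_point)
    (UV : forall i, U i `<=` V) (s : forall i, ringSections (U i)) :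
  (forall i, open (U i)) -> V = \bigcup_i U i ->
  (forall i j, restriction (@subIsetl _ (U i) (U j)) (s i) =
               restriction (@subIsetr _ (U i) (U j)) (s j)) ->
  exists t : ringSections V, forall i, restriction (UV i) t = s i.
Proof.
move=> oU eV agree.
have cover P : V P -> exists i, U i P.
  by rewrite eV => -[i _ UiP]; exists i.
pose t P (VP : V P) := s (projT1 (cid (cover P VP))) P (projT2 (cid (cover P VP))).
have tE i P (UiP : U i P) VP : t P VP = s i P UiP.
  rewrite /t; case: (cid _) => j UjP /=.
  have e := congr1 (fun u : ringSections (U i `&` U j) => u P (conj UiP UjP)) (agree i j).
  transitivity (restriction (@subIsetr _ (U i) (U j)) (s j) P (conj UiP UjP)).
    by congr (rsval (s j) _); apply: Prop_irrelevance.
  by rewrite -e; congr (rsval (s i) _); apply: Prop_irrelevance.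
have tP : locally_fraction t.
  move=> P VP; have [i UiP] := cover P VP.
  have [W [oW WP [N [f [g [fN [gN h]]]]]]] := rsvalP (s i) UiP.
  exists (W `&` U i); split=> //; first exact: openI.
  exists N, f, g, fN, gN => Q VQ [WQ UiQ]; rewrite (tE i Q UiQ); exact: h.
by exists (RingSection tP) => i; apply: ringSection_eq => P UiP /=; apply: tE.
Qed.

End ProjDef.

(* The rings attached to sets that are not open are irrelevant. *)
Record ringed_space := RingedSpace {
  rs_space :> topologicalType;
  rs_ring : set rs_space -> comPzRingType;
  rs_restrict : forall U V : set rs_space, V `<=` U ->
    {rmorphism rs_ring U -> rs_ring V};
  rs_restrict_comp : forall (U V W : set rs_space)
    (VU : V `<=` U) (WV : W `<=` V) (WU : W `<=` U) (s : rs_ring U),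
    rs_restrict WV (rs_restrict VU s) = rs_restrict WU s;
  rs_local : forall (I : Type) (U : I -> set rs_space) (V : set rs_space)
    (UV : forall i, U i `<=` V) (s t : rs_ring V),
    V = \bigcup_i U i ->
    (forall i, rs_restrict (UV i) s = rs_restrict (UV i) t) -> s = t;
  rs_glue : forall (I : Type) (U : I -> set rs_space) (V : set rs_space)
    (UV : forall i, U i `<=` V) (s : forall i, rs_ring (U i)),
    (forall i, open (U i)) -> V = \bigcup_i U i ->
    (forall i j, rs_restrict (@subIsetl _ (U i) (U j)) (s i) =
                 rs_restrict (@subIsetr _ (U i) (U j)) (s j)) ->
    exists t : rs_ring V, forall i, rs_restrict (UV i) t = s i }.

Definition Proj (K : comPzRingType) (A : gradedAlg K) : ringed_space :=
  @RingedSpace (proj_point A) (fun U => ringSections U) (fun U V VU => restriction VU)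
    (@restriction_comp K A) (@restriction_local K A) (@restriction_glue K A).

Section Isomorphisms.

(* Between locally ringed spaces, an isomorphism of ringed spaces is an
   isomorphism of locally ringed spaces. *)
Record ringed_iso (X Y : ringed_space) := RingedIso {
  riso :> X -> Y;
  riso_inv : Y -> X;
  risoK : cancel riso riso_inv;
  riso_invK : cancel riso_inv riso;
  riso_continuous : continuous riso;
  riso_inv_continuous : continuous riso_inv;
  riso_sheaf : forall V : set Y, open V ->
    {rmorphism rs_ring V -> rs_ring (riso @^-1` V)};
  riso_sheaf_bij : forall V (oV : open V), bijective (riso_sheaf oV);
  riso_sheaf_restrict : forall V W (oV : open V) (oW : open W)
    (WV : W `<=` V) (s : rs_ring V),
    riso_sheaf oW (rs_restrict WV s) =
    rs_restrict (preimage_subset WV) (riso_sheaf oV s) }.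

Variables (K : comPzRingType) (A B : gradedAlg K).

Record graded_iso := GradedIso {
  giso :> {rmorphism A -> B};
  giso_bij : bijective giso;
  giso_const : forall c, giso (gaConst A c) = gaConst B c;
  giso_piece : forall N f, piece A N f <-> piece B N (giso f) }.

(* On points F is P |-> Phi(P), and the germ of the pullback of s at P is f/g
   when the germ of s at F P is Phi(f)/Phi(g). *)
Definition induced_by (Phi : graded_iso) (F : ringed_iso (Proj A) (Proj B)) :=
  (forall (P : proj_point A) f, (F P : proj_point B) (Phi f) <-> P f) /\
  (forall (V : set (proj_point B)) (oV : open V) (s : ringSections V)
     (P : proj_point A) (VP : V (F P)) (x : hfrac P) (y : hfrac (F P)),
     hnum y = Phi (hnum x) -> hden y = Phi (hden x) ->
     ((riso_sheaf F oV s : ringSections (F @^-1` V)) P VP = \pi_(hloc P) x <->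
      s (F P) VP = \pi_(hloc (F P)) y)).

End Isomorphisms.

Definition set_arg (I : eqType) (T : Type) (u : I -> T) (i : I) (x : T) : I -> T :=
  fun j => if j == i then x else u j.

Lemma set_argE (I : eqType) (T : Type) (u : I -> T) i x j :
  set_arg u i x j = if j == i then x else u j.
Proof. by []. Qed.

Lemma set_arg_same (I : eqType) (T : Type) (u : I -> T) i : set_arg u i (u i) = u.
Proof. by apply/funext=> j; rewrite set_argE; case: eqP => // ->. Qed.

Section AlternatingForms.
Variables (F : fieldType).

Definition multilinear (V : lmodType F) (k : nat) (f : ('I_k -> V) -> F) :=
  forall (u : 'I_k -> V) (c : 'I_k) (a : F) (v w : V),
    f (set_arg u c (a *: v + w)) = a * f (set_arg u c v) + f (set_arg u c w).

Definition altform (V : lmodType F) (k : nat) (f : ('I_k -> V) -> F) :=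
  multilinear f /\ forall (u : 'I_k -> V) (c d : 'I_k), c != d -> u c = u d -> f u = 0.

Section Top.
Variable V : vectType F.

Lemma altform_tperm k (f : ('I_k -> V) -> F) : altform f ->
  forall u c d, c != d -> f (u \o tperm c d) = - f u.
Proof.
move=> [fl fa] u c d ne; set a := u c; set b := u d.
pose W x y := set_arg (set_arg u c x) d y.
have WC x y : W x y = set_arg (set_arg u d y) c x.
  apply/funext=> j; rewrite /W !set_argE.
  by case: eqVneq => // ->; rewrite eq_sym (negbTE ne).
have Wxx x : f (W x x) = 0.
  by apply: (fa _ c d) => //; rewrite /W !set_argE !eqxx (negbTE ne).
have lin2 x y z : f (W x (y + z)) = f (W x y) + f (W x z).
  by rewrite /W -[y]scale1r fl mul1r scale1r.
have lin1 x y z : f (W (y + z) x) = f (W y x) + f (W z x).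
  by rewrite !WC -[y]scale1r fl mul1r scale1r.
have -> : u \o tperm c d = W b a.
  apply/funext=> j; rewrite /W !set_argE /=.
  by case: tpermP => [->|->|/eqP/negbTE -> /eqP/negbTE ->]; rewrite ?eqxx ?(negbTE ne).
have -> : f u = f (W a b).
  congr (f _); apply/funext=> j; rewrite /W !set_argE.
  by case: eqVneq => [-> //|_]; case: eqVneq => [->|].
have := Wxx (a + b); rewrite lin2 !lin1 !Wxx add0r addr0.
by move/eqP; rewrite addr_eq0 => /eqP.
Qed.

Lemma altform_perm k (f : ('I_k -> V) -> F) : altform f ->
  forall u (s : 'S_k), f (u \o s) = (-1) ^+ s * f u.
Proof.
move=> fP u s; have [ts -> /=] := prod_tpermP s.
elim: ts => [_|[c d] ts IH /= /andP[ne /IH{}IH]].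
  rewrite big_nil odd_perm1 mul1r; congr (f _).
  by apply/funext=> j; rewrite /= perm1.
rewrite big_cons; set t := (\prod_(_ <- _) _)%g in IH *.
have -> : u \o (tperm c d * t)%g = (u \o t) \o tperm c d.
  by apply/funext=> j; rewrite /= permM.
by rewrite altform_tperm // IH odd_permM odd_tperm ne signr_addb expr1 mulN1r mulNr.
Qed.

Lemma multilinear_eq0 k (e : 'I_k -> V) (H : ('I_k -> V) -> F) :
  (forall v, exists M : 'I_k -> F, v = \sum_d M d *: e d) ->
  multilinear H -> (forall g : 'I_k -> 'I_k, H (e \o g) = 0) ->
  forall u, H u = 0.
Proof.
move=> span_e Hl He.
have H0 u c : H (set_arg u c 0) = 0.
  have := Hl u c 0 0 0; rewrite scale0r addr0 mul0r add0r => e0.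
  have := Hl u c (-1) 0 0; rewrite scaler0 addr0 mulN1r.
  by move->; rewrite addNr.
have P t : forall u, (forall c : 'I_k, (t <= c)%N -> exists d, u c = e d) -> H u = 0.
  elim: t => [|t IH] u ub.
    have /choice[g ug] : forall c : 'I_k, exists d, u c = e d by move=> c; apply: ub.
    by rewrite -(He g); congr (H _); apply/funext.
  have [tk|kt] := ltnP t k; last first.
    by apply: IH => c tc; have := leq_trans kt tc; rewrite leqNgt ltn_ord.
  pose c := Ordinal tk; have [M uM] := span_e (u c).
  rewrite -[u](set_arg_same u c) uM.
  apply: (big_ind (fun v => H (set_arg u c v) = 0)) => //.
    by move=> v w hv hw; rewrite -[v]scale1r Hl hv hw mulr0 addr0.
  move=> d _; rewrite -[_ *: _]addr0 Hl H0 addr0 IH ?mulr0 // => c' tc'.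
  rewrite set_argE; case: eqVneq => [_|ne]; first by exists d.
  by apply: ub; rewrite ltn_neqAle tc' andbT; apply: contra ne => /eqP e'; apply/eqP/val_inj.
by move=> u; apply: (P k) => c; rewrite leqNgt ltn_ord.
Qed.

Lemma altform_top k : \dim {:V} = k ->
  exists (e : 'I_k -> V) (D : ('I_k -> V) -> F),
    forall f, altform f -> forall u, f u = D u * f e.
Proof.
move=> <-; set b := vbasis {:V}.
pose e := fun c : 'I_(\dim {:V}) => b`_c.
pose D := fun u : 'I_(\dim {:V}) -> V => \det (\matrix_(c, d) coord b d (u c)).
exists e, D => f fP u; apply/eqP; rewrite -subr_eq0; apply/eqP.
have be d c : coord b d (e c) = (c == d)%:R.
  by rewrite /e coord_free ?(basis_free (vbasisP _)) // eq_sym.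
apply: (@multilinear_eq0 _ e (fun u => f u - D u * f e)) => {u}.
- move=> v; exists (fun d => coord b d v); apply: coord_vbasis; exact: memvf.
- move=> u c a v w; case: (fP) => fl _; rewrite fl.
  have -> : D (set_arg u c (a *: v + w)) = a * D (set_arg u c v) + 1 * D (set_arg u c w).
    apply: (determinant_multilinear (i0 := c)).
    - by apply/rowP=> d; rewrite !mxE !set_argE eqxx linearD linearZ /= mul1r.
    - by apply/matrixP=> i j; rewrite !mxE !set_argE eq_sym (negbTE (neq_lift _ _)).
    - by apply/matrixP=> i j; rewrite !mxE !set_argE eq_sym (negbTE (neq_lift _ _)).
  by ring.
move=> g; have [ig|] := boolP (injectiveb g); last first.
  move=> /injectivePn[c [d ne gcd]].
  rewrite (proj2 fP _ c d) //=; last by rewrite gcd.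
  by rewrite /D (determinant_alternate ne) ?mul0r ?subr0 // => d'; rewrite !mxE /= gcd.
have -> : g = perm (injectiveP _ ig) by apply/funext=> c; rewrite permE.
set s := perm _; rewrite altform_perm //.
have -> : D (e \o s) = (-1) ^+ s.
  rewrite -det_perm /D; congr (\det _); apply/matrixP=> c d.
  by rewrite !mxE /= be.
by rewrite subrr.
Qed.

End Top.
End AlternatingForms.

Section FlagManifolds.
Variables (R : realType) (n m : nat).
Local Notation C := R[i].
Local Notation Cn := 'cV[R[i]]_n.

Record flag (k : 'I_m -> nat) := Flag {
  flagV :> 'I_m -> {vspace Cn};
  flag_dim : forall i, \dim (flagV i) = k i;
  flag_incl : forall i j : 'I_m, (i <= j)%N -> (flagV i <= flagV j)%VS }.

Lemma flag_eq k (x y : flag k) : (forall i, x i = y i) -> x = y.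
Proof.
case: x y => [x dx ix] [y dy iy] /= exy; have e : x = y by apply/funext.
by rewrite -e in dy iy *; congr Flag; apply: Prop_irrelevance.
Qed.

(* The fibre at x of the line bundle of weight p is the tensor product of the
   lines Alt^(k i) (x i)^*, the i-th one taken p i times. It is realised as a
   space of functions of families v of vectors, where v i j c (in x i) is the
   c-th argument of the j-th factor with index i: functions which only depend
   on the blocks v i j with j < p i and which are multilinear and alternating
   in each block. The tensor product of forms is then their pointwise
   product. *)
Definition args k (x : flag k) := forall i : 'I_m, nat -> 'I_(k i) -> subvs_of (x i).

Definition set_block k (x : flag k) (v : args x) (i : 'I_m) (j : nat)
    (u : 'I_(k i) -> subvs_of (x i)) : args x :=
  dfwith v (i := i) (set_arg (v i) j u).

Arguments set_block {k x} v i j u.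

Definition in_fibre k (p : 'I_m -> nat) (x : flag k) (phi : args x -> C) :=
  (forall v w : args x,
     (forall i j c, (j < p i)%N -> v i j c = w i j c) -> phi v = phi w) /\
  (forall (v : args x) i j, (j < p i)%N ->
     altform (fun u => phi (set_block v i j u))).

(* The identification of a tensor product of fibres of weights p and q with
   the fibre of weight p + q: the first p i factors with index i belong to
   phi, the next q i ones to psi. *)
Definition skip k (p : 'I_m -> nat) (x : flag k) (v : args x) : args x :=
  fun i j => v i (p i + j)%N.
Definition tensor k (p : 'I_m -> nat) (x : flag k) (phi psi : args x -> C) :
    args x -> C :=
  fun v => phi v * psi (skip p v).

Definition bsection k := forall x : flag k, args x -> C.

(* GL_n -> F_k, sending g to the flag of the spans of its first columns, is a
   holomorphic principal bundle; the pullback of a homogeneous line bundle is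
   trivialised by evaluation at the columns of g, and a section is holomorphic
   when its pullback is a holomorphic function on the open subset GL_n of the
   space of matrices. The values of f outside GL_n are irrelevant. *)
Definition columns (g : 'M[C]_n) : seq Cn := [seq col c g | c <- enum 'I_n].

Definition spanned_by k (x : flag k) (g : 'M[C]_n) :=
  forall i, x i = <<take (k i) (columns g)>>%VS.

Definition frame k (x : flag k) (g : 'M[C]_n) : args x :=
  fun i _ c => vsproj (x i) (columns g)`_c.

Definition holomorphic k (s : bsection k) :=
  exists f : ('M[C]_n : normedModType C) -> C^o,
    (forall g : ('M[C]_n : normedModType C), g \in unitmx -> differentiable f g) /\
    (forall (g : 'M[C]_n) (x : flag k), g \in unitmx -> spanned_by x g ->
       s x (frame x g) = f g).

Record torus := Torus {
  torus_coord :> 'I_n -> C;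
  torus_neq0 : forall i, torus_coord i != 0 }.

Definition torus_mx (z : torus) : 'M[C]_n := diag_mx (\row_i z i).

Lemma torus_inv_neq0 (z : torus) i : (z i)^-1 != 0.
Proof. by rewrite invr_eq0 torus_neq0. Qed.
Definition torus_inv (z : torus) := Torus (torus_inv_neq0 z).

Lemma torus_mxE z (u : Cn) i : (torus_mx z *m u) i 0 = z i * u i 0.
Proof. by rewrite mul_diag_mx !mxE. Qed.

Lemma torus_mx_inj z : lker (linfun (mulmx (torus_mx z) : Cn -> Cn)) == 0%VS.
Proof.
apply/lker0P => u v; rewrite !lfunE /= => e; apply/colP => i.
by have /colP/(_ i) := e; rewrite !torus_mxE => /(mulfI (torus_neq0 z i)).
Qed.

Definition torus_space (z : torus) (V : {vspace Cn}) : {vspace Cn} :=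
  (linfun (mulmx (torus_mx z)) @: V)%VS.

Lemma torus_flag_dim k z (x : flag k) i : \dim (torus_space z (x i)) = k i.
Proof.
rewrite /torus_space limg_dim_eq ?flag_dim //.
by have /eqP -> := torus_mx_inj z; rewrite capv0.
Qed.

Lemma torus_flag_incl k z (x : flag k) (i j : 'I_m) : (i <= j)%N ->
  (torus_space z (x i) <= torus_space z (x j))%VS.
Proof. by move=> ij; apply/limgS/flag_incl. Qed.

Definition torus_flag k z (x : flag k) : flag k :=
  Flag (torus_flag_dim z x) (@torus_flag_incl k z x).

Definition torus_char (t : 'I_n -> int) (z : torus) : C := \prod_i z i ^ t i.

(* (h . s)(x) = h . s(h^-1 x) for the action of h on the bundle twisted by the
   character t; on a fibre, (h . phi)(v) = phi(h^-1 v). *)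
Definition torus_act k (t : 'I_n -> int) (z : torus) (s : bsection k) :
    bsection k :=
  fun x v => torus_char t z *
    s (torus_flag (torus_inv z) x)
      (fun i j c => vsproj _ (torus_mx (torus_inv z) *m vsval (v i j c))).

(* The space of H-invariant holomorphic sections of the line bundle of weight p
   twisted by the character t. *)
Definition inv_section k (p : 'I_m -> nat) (t : 'I_n -> int) (s : bsection k) :=
  [/\ forall x, in_fibre p (s x), holomorphic s
    & forall z, torus_act t z s = s].

Section InvariantSections.
Variable k : 'I_m -> nat.
Implicit Types (p q : 'I_m -> nat) (t : 'I_n -> int) (s : bsection k).

Lemma in_fibre0 p (x : flag k) : in_fibre p (fun _ : args x => 0).
Proof.
split=> // v i j _; split=> [u c a v' w'|//].
by rewrite mulr0 addr0.
Qed.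

Lemma in_fibreD p (x : flag k) (phi psi : args x -> C) :
  in_fibre p phi -> in_fibre p psi -> in_fibre p (fun v => phi v + psi v).
Proof.
move=> [d1 a1] [d2 a2]; split=> [v w e|v i j jp]; first by rewrite (d1 v w) ?(d2 v w).
have [l1 z1] := a1 v i j jp; have [l2 z2] := a2 v i j jp.
split=> [u c b v' w'|u c d ne e]; last by rewrite (z1 u c d) ?(z2 u c d) ?addr0.
by rewrite l1 l2; ring.
Qed.

Lemma in_fibreZ p (x : flag k) b (phi : args x -> C) :
  in_fibre p phi -> in_fibre p (fun v => b * phi v).
Proof.
move=> [d1 a1]; split=> [v w e|v i j jp]; first by rewrite (d1 v w).
have [l1 z1] := a1 v i j jp.
split=> [u c b' v' w'|u c d ne e]; last by rewrite (z1 u c d) ?mulr0.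
by rewrite l1; ring.
Qed.

Lemma set_blockE (x : flag k) (v : args x) i j u j' :
  set_block v i j u i j' = if j' == j then u else v i j'.
Proof. by rewrite /set_block dfwith_in. Qed.

Lemma set_block_out (x : flag k) (v : args x) i j u i' j' :
  i != i' -> set_block v i j u i' j' = v i' j'.
Proof. by move=> ne; rewrite /set_block dfwith_out. Qed.

Lemma args_eq (x : flag k) (v w : args x) : (forall i j, v i j = w i j) -> v = w.
Proof. by move=> e; apply: functional_extensionality_dep => i; apply/funext=> j. Qed.

Lemma in_fibre_tensor p q (x : flag k) (phi psi : args x -> C) :
  in_fibre p phi -> in_fibre q psi ->
  in_fibre (fun i => p i + q i)%N (tensor p phi psi).
Proof.
move=> [d1 a1] [d2 a2]; split=> [v w e|v i j jpq].
  rewrite /tensor (d1 v w) ?(d2 (skip p v) (skip p w)) // => i j c jp.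
    by apply: e; rewrite ltn_add2l.
  by apply: e; apply: leq_trans jp (leq_addr _ _).
have [jp|pj] := ltnP j (p i).
  have es u : skip p (set_block v i j u) = skip p v.
    apply: args_eq => i' j'; have [e|ne] := eqVneq i i'; last first.
      by rewrite /skip set_block_out.
    subst i'; rewrite /skip set_blockE; case: eqP => // e.
    by move: jp; rewrite -e ltnNge leq_addr.
  have [l1 z1] := a1 v i j jp; rewrite /tensor; split=> [u c b v' w'|u c d ne e].
    by rewrite !es l1; ring.
  by rewrite (z1 u c d) ?mul0r.
have es u : skip p (set_block v i j u) = set_block (skip p v) i (j - p i)%N u.
  apply: args_eq => i' j'; have [e|ne] := eqVneq i i'; last first.
    by rewrite /skip !set_block_out.
  subst i'; rewrite /skip !set_blockE.
  by rewrite -{1}(subnKC pj) eqn_add2l.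
have ep u : phi (set_block v i j u) = phi v.
  apply: d1 => i' j' c jp; have [e|ne] := eqVneq i i'; last first.
    by rewrite set_block_out.
  subst i'; rewrite set_blockE; case: eqP => // e.
  by move: jp; rewrite e ltnNge pj.
have [|l2 z2] := a2 (skip p v) i (j - p i)%N; first by rewrite ltn_subLR.
rewrite /tensor; split=> [u c b v' w'|u c d ne e].
  by rewrite !es !ep l2; ring.
by rewrite es (z2 u c d) ?mulr0.
Qed.

(* Fibres are lines: up to the choice of a basis of the subspaces, an element
   of the fibre is a product of determinants. *)
Lemma in_fibre_top (x : flag k) : exists (e : args x)
    (D : forall i, ('I_(k i) -> subvs_of (x i)) -> C),
  (forall p, skip p e = e) /\
  (forall p phi, in_fibre p phi -> forall v,
     phi v = (\prod_i \prod_(j < p i) D i (v i j)) * phi e).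
Proof.
have h i : {eD : ('I_(k i) -> subvs_of (x i)) * (('I_(k i) -> subvs_of (x i)) -> C) |
    forall f, altform f -> forall u, f u = eD.2 u * f eD.1}.
  apply: cid; have [|e [D eD]] := @altform_top C (subvs_of (x i)) (k i).
    by rewrite dimvf -(flag_dim x i).
  by exists (e, D).
pose e : args x := fun i _ => (sval (h i)).1.
pose D i := (sval (h i)).2; exists e, D; split=> // p phi [dphi aphi] v.
pose rv (l : seq ('I_m * nat)) : args x :=
  fun i j => if (i, j) \in l then e i j else v i j.
have step (l : seq ('I_m * nat)) : uniq l ->
    (forall y, y \in l -> (y.2 < p y.1)%N) ->
    phi v = (\prod_(y <- l) D y.1 (v y.1 y.2)) * phi (rv l).
  elim: l => [|[i j] l IH] /=.
    by move=> _ _; rewrite big_nil mul1r.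
  move=> /andP[nin us] lt; rewrite IH //; last first.
    by move=> y yl; apply: lt; rewrite inE yl orbT.
  rewrite big_cons /= [D i _ * _]mulrC -mulrA; congr (_ * _).
  have jp : (j < p i)%N by apply: (lt (i, j)); rewrite inE eqxx.
  have := svalP (h i) _ (aphi (rv l) i j jp) (v i j).
  have -> : set_block (rv l) i j (v i j) = rv l.
    apply: args_eq => i' j'; have [ee|ne] := eqVneq i i'; last by rewrite set_block_out.
    subst i'; rewrite set_blockE; case: eqP => // ->.
    by rewrite /rv (negbTE nin).
  move=> ->; congr (_ * phi _).
  apply: args_eq => i' j'; have [ee|ne] := eqVneq i i'.
    subst i'; rewrite set_blockE /rv inE xpair_eqE eqxx /=.
    by case: eqP.
  by rewrite set_block_out // /rv inE xpair_eqE eq_sym (negbTE ne).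
pose l := [seq (i, j) | i <- enum 'I_m, j <- iota 0 (p i)].
have us : uniq l.
  apply: allpairs_uniq_dep => [|i _|]; first exact: enum_uniq.
    exact: iota_uniq.
  by move=> [i j] [i' j'] _ _ /= [-> ->].
have ls y : y \in l -> (y.2 < p y.1)%N.
  by move=> /allpairsPdep[i [j [_ ji ->]]] /=; rewrite mem_iota add0n in ji.
rewrite (step l us ls) big_allpairs_dep big_enum /=; congr (_ * _).
  apply: eq_bigr => i _.
  by rewrite -{1}[p i]subn0 -/(index_iota 0 (p i)) big_mkord.
apply: dphi => i j c jp; rewrite /rv.
have -> // : (i, j) \in l.
by apply/allpairsPdep; exists i, j; rewrite mem_enum mem_iota.
Qed.

Lemma tensorC p q (x : flag k) (phi psi : args x -> C) :
  in_fibre p phi -> in_fibre q psi -> tensor p phi psi = tensor q psi phi.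
Proof.
move=> hphi hpsi; apply/funext=> v.
have [e [D [eE DE]]] := in_fibre_top x.
have E a b (ch ps : args x -> C) : in_fibre a ch -> in_fibre b ps ->
    tensor a ch ps v =
    (\prod_i \prod_(j < a i + b i) D i (v i j)) * (ch e * ps e).
  move=> hch hps; rewrite /tensor (DE a) // (DE b ps) // mulrACA; congr (_ * _).
  rewrite -big_split /=; apply: eq_bigr => i _; rewrite big_split_ord /=.
  by congr (_ * _); apply: eq_bigr.
rewrite (E p q) // (E q p) // mulrC [RHS]mulrC [psi e * _]mulrC; congr (_ * _).
by apply: eq_bigr => i _; rewrite addnC.
Qed.

Lemma torus_charD t t' z :
  torus_char (fun i => t i + t' i) z = torus_char t z * torus_char t' z.
Proof.
rewrite /torus_char -big_split /=; apply: eq_bigr => i _.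
by rewrite expfzDr ?torus_neq0.
Qed.

Lemma inv_section0 p t : inv_section p t (fun (x : flag k) _ => 0).
Proof.
split=> [x||z]; first exact: in_fibre0.
  by exists (cst 0); split=> // g _; apply: differentiable_cst.
apply: functional_extensionality_dep => x; apply/funext=> v.
by rewrite /torus_act mulr0.
Qed.

Lemma inv_sectionD p t s s' : inv_section p t s -> inv_section p t s' ->
  inv_section p t (fun x v => s x v + s' x v).
Proof.
move=> [f1 [h1 [d1 e1]] i1] [f2 [h2 [d2 e2]] i2]; split=> [x||z].
- exact: in_fibreD.
- exists (h1 + h2); split=> [g gu|g x gu sp]; last by rewrite (e1 g) // (e2 g).
  by apply: differentiableD; [apply: d1|apply: d2].
by rewrite -{2}(i1 z) -{2}(i2 z); apply: functional_extensionality_dep => x;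
  apply/funext=> v; rewrite /torus_act mulrDr.
Qed.

Lemma inv_sectionZ p t b s : inv_section p t s ->
  inv_section p t (fun x v => b * s x v).
Proof.
move=> [f1 [h1 [d1 e1]] i1]; split=> [x||z]; first exact: in_fibreZ.
  exists (b \*: h1); split=> [g gu|g x gu sp]; last by rewrite (e1 g).
  by apply: differentiableZ; apply: d1.
by rewrite -{2}(i1 z); apply: functional_extensionality_dep => x;
  apply/funext=> v; rewrite /torus_act mulrCA.
Qed.

Lemma inv_section_tensor p q t t' s s' :
  inv_section p t s -> inv_section q t' s' ->
  inv_section (fun i => p i + q i)%N (fun i => t i + t' i)
    (fun x => tensor p (s x) (s' x)).
Proof.
move=> [f1 [h1 [d1 e1]] i1] [f2 [h2 [d2 e2]] i2]; split=> [x||z].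
- exact: in_fibre_tensor.
- exists (fun g => h1 g * h2 g); split=> [g gu|g x gu sp]; last first.
    by rewrite -(e1 g x) // -(e2 g x).
  by apply: differentiableM; [apply: d1|apply: d2].
rewrite -{2}(i1 z) -{2}(i2 z); apply: functional_extensionality_dep => x.
by apply/funext=> v; rewrite /torus_act /tensor torus_charD mulrACA.
Qed.

Lemma inv_section_const b :
  inv_section (fun=> 0%N) (fun=> 0) (fun (x : flag k) _ => b).
Proof.
split=> [x||z]; first by split.
  by exists (cst b); split=> // g _; apply: differentiable_cst.
apply: functional_extensionality_dep => x; apply/funext=> v.
by rewrite /torus_act /torus_char big1 ?mul1r // => i _; rewrite expr0z.
Qed.

End InvariantSections.

Section InvariantRing.
Variables (k a : 'I_m -> nat) (t : 'I_n -> int).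

Definition power (N : nat) : 'I_m -> nat := fun i => (N * a i)%N.
Definition power_char (N : nat) : 'I_n -> int := fun i => N%:Z * t i.

(* The direct sum over N of the spaces of invariant sections of the N-th powers
   of the linearized line bundle. *)
Record inv_ring := InvRing {
  inv_component :> nat -> bsection k;
  inv_componentP : forall N,
    inv_section (power N) (power_char N) (inv_component N);
  inv_component_fin : exists d, forall N, (d <= N)%N ->
    inv_component N = fun x _ => 0 }.

Lemma inv_ring_eq (f g : inv_ring) :
  (forall N x v, f N x v = g N x v) -> f = g.
Proof.
case: f g => [f fP ff] [g gP gf] /= fg; have e : f = g.
  apply/funext=> N; apply: functional_extensionality_dep => x; apply/funext=> v.
  exact: fg.
by rewrite -e in gP gf *; congr InvRing; apply: Prop_irrelevance.
Qed.

HB.instance Definition _ := gen_eqMixin inv_ring.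
HB.instance Definition _ := gen_choiceMixin inv_ring.

Lemma inv_zero_fin : exists d, forall N, (d <= N)%N ->
  (fun x _ => 0) = (fun x _ => 0) :> bsection k.
Proof. by exists 0%N. Qed.

Definition inv_zero : inv_ring :=
  @InvRing (fun _ _ _ => 0) (fun N => inv_section0 _ _ _) inv_zero_fin.

Lemma inv_add_fin (f g : inv_ring) : exists d, forall N, (d <= N)%N ->
  (fun x v => f N x v + g N x v) = (fun x _ => 0) :> bsection k.
Proof.
have [d df] := inv_component_fin f; have [e eg] := inv_component_fin g.
exists (maxn d e) => N; rewrite geq_max => /andP[dN eN]; rewrite df // eg //.
by apply: functional_extensionality_dep => x; apply/funext=> v; rewrite addr0.
Qed.

Definition inv_add (f g : inv_ring) : inv_ring :=
  @InvRing (fun N x v => f N x v + g N x v)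
    (fun N => inv_sectionD (inv_componentP f N) (inv_componentP g N))
    (inv_add_fin f g).

Lemma inv_scale_fin (b : C) (f : inv_ring) : exists d, forall N, (d <= N)%N ->
  (fun x v => b * f N x v) = (fun x _ => 0) :> bsection k.
Proof.
have [d df] := inv_component_fin f; exists d => N dN; rewrite df //.
by apply: functional_extensionality_dep => x; apply/funext=> v; rewrite mulr0.
Qed.

Definition inv_scale (b : C) (f : inv_ring) : inv_ring :=
  @InvRing (fun N x v => b * f N x v)
    (fun N => inv_sectionZ b (inv_componentP f N)) (inv_scale_fin b f).

Lemma inv_constP (b : C) N : inv_section (power N) (power_char N)
  (fun (x : flag k) _ => if N == 0%N then b else 0).
Proof.
case: N => [|N] /=; last exact: inv_section0.
have -> : power 0 = fun=> 0%N by apply/funext=> i; apply: mul0n.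
have -> : power_char 0 = fun=> 0 by apply/funext=> i; apply: mul0r.
exact: inv_section_const.
Qed.

Lemma inv_const_fin (b : C) : exists d, forall N, (d <= N)%N ->
  (fun x _ => if N == 0%N then b else 0) = (fun x _ => 0) :> bsection k.
Proof. by exists 1%N; case. Qed.

Definition inv_const (b : C) : inv_ring :=
  @InvRing (fun N x _ => if N == 0%N then b else 0) (inv_constP b)
    (inv_const_fin b).

Definition inv_mul_val (f g : inv_ring) N : bsection k := fun x v =>
  \sum_(i < N.+1) tensor (power i) (f i x) (g (N - i)%N x) v.

Lemma inv_mulP (f g : inv_ring) N :
  inv_section (power N) (power_char N) (inv_mul_val f g N).
Proof.
have term (i : 'I_N.+1) : inv_section (power N) (power_char N)
    (fun x => tensor (power i) (f i x) (g (N - i)%N x)).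
  have iN : (i + (N - i))%N = N by rewrite subnKC // -ltnS.
  have -> : power N = (fun l => power i l + power (N - i) l)%N.
    by apply/funext=> l; rewrite /power -mulnDl iN.
  have -> : power_char N = (fun l => power_char i l + power_char (N - i) l).
    by apply/funext=> l; rewrite /power_char -mulrDl -PoszD iN.
  exact: inv_section_tensor (inv_componentP f i) (inv_componentP g (N - i)%N).
have S d (h : 'I_d -> bsection k) :
    (forall i, inv_section (power N) (power_char N) (h i)) ->
    inv_section (power N) (power_char N) (fun x v => \sum_(i < d) h i x v).
  elim: d h => [|d IH] h hP.
    rewrite (_ : (fun _ _ => _) = fun x _ => 0); first exact: inv_section0.
    apply: functional_extensionality_dep => x; apply/funext=> v.
    by rewrite big_ord0.
  rewrite (_ : (fun _ _ => _) = fun x v =>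
    (\sum_(i < d) h (widen_ord (leqnSn d) i) x v) + h ord_max x v).
    by apply: inv_sectionD => //; apply: IH.
  apply: functional_extensionality_dep => x; apply/funext=> v.
  by rewrite big_ord_recr.
exact: S term.
Qed.

Lemma inv_mul_fin (f g : inv_ring) : exists d, forall N, (d <= N)%N ->
  inv_mul_val f g N = fun x _ => 0.
Proof.
have [d df] := inv_component_fin f; have [e eg] := inv_component_fin g.
exists (d + e)%N => N deN.
apply: functional_extensionality_dep => x; apply/funext=> v.
rewrite /inv_mul_val big1 // => i _; rewrite /tensor.
have [di|id] := leqP d i; first by rewrite df // mul0r.
have iN : (i <= N)%N by rewrite -ltnS.
by rewrite eg ?mulr0 // -(leq_add2l i) subnKC // (leq_trans _ deN) // leq_add2r ltnW.
Qed.

Definition inv_mul (f g : inv_ring) : inv_ring :=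
  InvRing (inv_mulP f g) (inv_mul_fin f g).

Lemma inv_addA : associative inv_add.
Proof. by move=> f g h; apply: inv_ring_eq => N x v /=; rewrite addrA. Qed.

Lemma inv_addC : commutative inv_add.
Proof. by move=> f g; apply: inv_ring_eq => N x v /=; rewrite addrC. Qed.

Lemma inv_add0 : left_id inv_zero inv_add.
Proof. by move=> f; apply: inv_ring_eq => N x v /=; rewrite add0r. Qed.

Lemma inv_addN : left_inverse inv_zero (inv_scale (-1)) inv_add.
Proof.
by move=> f; apply: inv_ring_eq => N x v /=; rewrite mulN1r addNr.
Qed.

HB.instance Definition _ := GRing.isZmodule.Build inv_ring
  inv_addA inv_addC inv_add0 inv_addN.

Lemma sum_triangle (V : zmodType) (G : nat -> nat -> V) N :
  \sum_(l < N.+1) \sum_(i < l.+1) G i l =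
  \sum_(i < N.+1) \sum_(j < (N - i).+1) G i (i + j)%N.
Proof.
elim: N => [|N IH].
  by rewrite !big_ord_recr !big_ord0 /= ?big_ord_recr ?big_ord0 /= ?addn0.
rewrite big_ord_recr /= IH [RHS]big_ord_recr /= subnn big_ord1 addn0.
rewrite [\sum_(i < N.+2) _]big_ord_recr /= addrA -big_split /=.
congr (_ + _); apply: eq_bigr => i _.
have iN : (i <= N)%N by rewrite -ltnS.
by rewrite (subSn iN) [RHS]big_ord_recr /= addnS subnKC.
Qed.

Lemma inv_mulA : associative inv_mul.
Proof.
move=> f g h; apply: inv_ring_eq => N x v /=; rewrite /inv_mul_val.
pose G i l := f i x v * g (l - i)%N x (skip (power i) v) *
  h (N - l)%N x (skip (power l) v).
rewrite (eq_bigr (fun i : 'I_N.+1 => \sum_(j < (N - i).+1) G i (i + j)%N)).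
  rewrite -sum_triangle; apply: eq_bigr => l _.
  by rewrite /tensor /= /inv_mul_val mulr_suml.
move=> i _; rewrite /tensor /= /inv_mul_val mulr_sumr; apply: eq_bigr => j _.
rewrite /G /tensor mulrA addKn subnDA; congr (_ * h _ x _).
by apply: args_eq => i' j'; rewrite /skip /power addnA mulnDl.
Qed.

Lemma inv_mulC : commutative inv_mul.
Proof.
move=> f g; apply: inv_ring_eq => N x v /=; rewrite /inv_mul_val.
rewrite (reindex_inj rev_ord_inj) /=; apply: eq_bigr => i _.
have iN : (i <= N)%N by rewrite -ltnS.
rewrite subSS (subKn iN) (@tensorC _ (power (N - i)) (power i)) //.
- by have [] := inv_componentP f (N - i)%N.
- by have [] := inv_componentP g i.
Qed.

Lemma inv_mul_const (b : C) f : inv_mul (inv_const b) f = inv_scale b f.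
Proof.
apply: inv_ring_eq => N x v /=; rewrite /inv_mul_val.
rewrite big_ord_recl big1 ?addr0 => [|i _]; last by rewrite /tensor /= mul0r.
by rewrite /tensor /= subn0.
Qed.

Lemma inv_mul1 : left_id (inv_const 1) inv_mul.
Proof.
by move=> f; rewrite inv_mul_const; apply: inv_ring_eq => N x v /=; rewrite mul1r.
Qed.

Lemma inv_mulDl : left_distributive inv_mul inv_add.
Proof.
move=> f g h; apply: inv_ring_eq => N x v /=; rewrite /inv_mul_val -big_split /=.
by apply: eq_bigr => i _; rewrite /tensor mulrDl.
Qed.

HB.instance Definition _ := GRing.Zmodule_isComPzRing.Build inv_ring
  inv_mulA inv_mulC inv_mul1 inv_mulDl.

Lemma inv_const_zmod : zmod_morphism inv_const.
Proof.
move=> b c; apply: inv_ring_eq => N x v /=.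
by case: eqP => _; rewrite mulN1r // oppr0 addr0.
Qed.

Lemma inv_const_monoid : monoid_morphism inv_const.
Proof.
split=> // b c; rewrite [RHS]inv_mul_const; apply: inv_ring_eq => N x v /=.
by case: eqP => _; rewrite ?mulr0.
Qed.

HB.instance Definition _ := GRing.isZmodMorphism.Build C inv_ring inv_const
  inv_const_zmod.
HB.instance Definition _ := GRing.isMonoidMorphism.Build C inv_ring inv_const
  inv_const_monoid.

Definition inv_piece (N : nat) : set inv_ring :=
  [set f | forall M, M != N -> f M = fun x _ => 0].

Lemma inv_piece0 N : inv_piece N 0.
Proof. by []. Qed.

Lemma inv_pieceB N f g : inv_piece N f -> inv_piece N g -> inv_piece N (f - g).
Proof.
move=> hf hg M MN; apply: functional_extensionality_dep => x; apply/funext=> v.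
by rewrite /= hf // hg // mulr0 addr0.
Qed.

Lemma inv_pieceM M N f g :
  inv_piece M f -> inv_piece N g -> inv_piece (M + N)%N (f * g).
Proof.
move=> hf hg L LMN; apply: functional_extensionality_dep => x; apply/funext=> v.
rewrite /= /inv_mul_val big1 // => i _; rewrite /tensor.
have [iM|iM] := eqVneq (i : nat) M; last by rewrite hf // mul0r.
rewrite hg ?mulr0 //; apply: contra LMN => /eqP <-.
by rewrite -iM subnKC // -ltnS.
Qed.

Lemma inv_piece_const b : inv_piece 0%N (inv_const b).
Proof. by case. Qed.

Lemma inv_truncP (f : inv_ring) L N : inv_section (power N) (power_char N)
  (fun (x : flag k) v => if N == L then f N x v else 0).
Proof. by case: eqP => _; [apply: inv_componentP|apply: inv_section0]. Qed.

Lemma inv_trunc_fin (f : inv_ring) L : exists d, forall N, (d <= N)%N ->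
  (fun x v => if N == L then f N x v else 0) = (fun x _ => 0) :> bsection k.
Proof. by exists L.+1 => N; case: eqP => // ->; rewrite ltnn. Qed.

Definition inv_trunc (f : inv_ring) L : inv_ring :=
  InvRing (inv_truncP f L) (inv_trunc_fin f L).

Lemma inv_sumE d (h : nat -> inv_ring) N x v :
  (\sum_(i < d) h i) N x v = \sum_(i < d) h i N x v.
Proof.
by elim: d => [|d IH]; rewrite ?big_ord0 // !big_ord_recr /= IH.
Qed.

Lemma inv_piece_sum f : exists (d : nat) (h : nat -> inv_ring),
  (forall N, inv_piece N (h N)) /\ f = \sum_(N < d) h N.
Proof.
have [d df] := inv_component_fin f; exists d, (inv_trunc f); split.
  by move=> N M MN; rewrite /= (negbTE MN).
apply: inv_ring_eq => N x v; rewrite inv_sumE /=.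
have [dN|Nd] := leqP d N.
  by rewrite df // big1 // => i _; case: eqP.
rewrite (bigD1 (Ordinal Nd)) //= eqxx big1 ?addr0 // => i.
by rewrite -val_eqE /= eq_sym => /negbTE ->.
Qed.

Lemma inv_piece_direct d (h : nat -> inv_ring) :
  (forall N, inv_piece N (h N)) -> \sum_(N < d) h N = 0 ->
  forall N, (N < d)%N -> h N = 0.
Proof.
move=> hP h0 N Nd; apply: inv_ring_eq => M x v.
have [->|MN] := eqVneq M N; last by rewrite hP.
have := inv_sumE d h N v; rewrite h0 (bigD1 (Ordinal Nd)) //= big1.
  by rewrite addr0 => <-.
by move=> i; rewrite -val_eqE /= eq_sym => iN; rewrite hP // eq_sym.
Qed.

Definition inv_alg : gradedAlg C := GradedAlg
  inv_piece0 inv_pieceB inv_pieceM inv_piece_const inv_piece_sum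
  inv_piece_direct.

(* The quotient of F_k by H for the linearized bundle with weight a and
   character t. *)
Definition mumford_quotient := Proj inv_alg.

End InvariantRing.
End FlagManifolds.

Section Duality.
Variables (R : realType) (n m : nat).
Local Notation C := R[i].
Local Notation Cn := 'cV[R[i]]_n.

Definition bform (u v : Cn) : C := \sum_i u i 0 * v i 0.

Definition perp (V : {vspace Cn}) : {vspace Cn} :=
  (\bigcap_(u <- vbasis V) lker (linfun (mulmx u^T : Cn -> 'cV[C]_1)))%VS.

Lemma mulmx_bform (u v : Cn) : u^T *m v = (bform u v)%:M.
Proof.
apply/matrixP=> i j; rewrite !ord1 !mxE /= mulr1n.
by apply: eq_bigr => l _; rewrite mxE.
Qed.

Lemma bformC u v : bform u v = bform v u.
Proof. by apply: eq_bigr => i _; rewrite mulrC. Qed.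

Lemma bform_suml (I : Type) (s : seq I) (b : I -> C) (u : I -> Cn) v :
  bform (\sum_(i <- s) b i *: u i) v = \sum_(i <- s) b i * bform (u i) v.
Proof.
rewrite /bform; under [RHS]eq_bigr do rewrite mulr_sumr.
rewrite exchange_big /=; apply: eq_bigr => l _.
by rewrite summxE mulr_suml; apply: eq_bigr => i _; rewrite mxE mulrA.
Qed.

Lemma mem_perp (V : {vspace Cn}) w :
  w \in perp V <-> forall u, u \in V -> bform u w = 0.
Proof.
have -> : (w \in perp V) = all (fun u => bform u w == 0) (vbasis V).
  rewrite /perp; elim: (tval _) => [|u s IH]; first by rewrite big_nil memvf.
  rewrite big_cons memv_cap IH memv_ker lfunE /= mulmx_bform; congr (_ && _).
  apply/eqP/eqP=> [/matrixP/(_ 0 0)|->]; first by rewrite !mxE.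
  by apply/matrixP=> i j; rewrite !mxE mul0rn.
split=> [/allP h u uV|h]; last by apply/allP=> u /vbasis_mem uV; apply/eqP/h.
rewrite (coord_vbasis uV) bform_suml big1 // => i _.
have /h/eqP -> : (vbasis V)`_i \in tval (vbasis V) by rewrite mem_nth ?size_tuple.
by rewrite mulr0.
Qed.

Lemma dim_perp (V : {vspace Cn}) : \dim (perp V) = (n - \dim V)%N.
Proof.
pose M : 'M[C]_(\dim V, n) := \matrix_(c, i) (vbasis V)`_c i 0.
have ME c (w : Cn) : (M *m w) c 0 = bform (vbasis V)`_c w.
  by rewrite mxE; apply: eq_bigr => i _; rewrite mxE.
have -> : perp V = lker (linfun (mulmx M : Cn -> 'cV[C]_(\dim V))).
  apply/vspaceP=> w; rewrite memv_ker lfunE /=; apply/idP/eqP.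
    move=> /mem_perp h; apply/colP=> c; rewrite ME mxE h //.
    by apply/vbasis_mem/mem_nth; rewrite size_tuple.
  move=> e; apply/mem_perp => u uV; rewrite (coord_vbasis uV) bform_suml big1 //.
  by move=> c _; rewrite -ME e mxE mulr0.
set f := linfun _.
have Mfree : row_free M.
  apply: inj_row_free => v vM; apply/rowP=> c; rewrite mxE.
  have /freeP := basis_free (vbasisP V); apply => //; apply/colP=> i.
  have /rowP/(_ i) := vM; rewrite !mxE summxE => e; rewrite -[RHS]e.
  by apply: eq_bigr => d _; rewrite !mxE.
have imf : limg f = fullv.
  apply/vspaceP=> w; rewrite memvf.
  apply/memv_imgP; exists (pinvmx M *m w); first exact: memvf.
  by rewrite lfunE /= mulmxA mulmxVp // mul1mx.
have E : (\dim (lker f) + \dim V = n)%N.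
  by have := limg_ker_dim f fullv; rewrite imf capfv !dimvf /dim /= !muln1.
have -> : \dim (lker f) = (\dim (lker f) + \dim V - \dim V)%N by rewrite addnK.
by rewrite E.
Qed.

Lemma perpS (V W : {vspace Cn}) : (V <= W)%VS -> (perp W <= perp V)%VS.
Proof.
move=> /subvP VW; apply/subvP=> w /mem_perp h; apply/mem_perp=> u /VW.
exact: h.
Qed.

Lemma perpK (V : {vspace Cn}) : perp (perp V) = V.
Proof.
apply/esym/eqP; rewrite eqEdim !dim_perp subKn ?leqnn ?andbT.
  apply/subvP=> u uV; apply/mem_perp=> w /mem_perp h.
  by rewrite bformC h.
by rewrite (leq_trans (dimvS (subvf V))) // dimvf /dim /= muln1.
Qed.

Definition dual_dims (k : 'I_m -> nat) : 'I_m -> nat :=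
  fun i => (n - k (rev_ord i))%N.
Definition dual_weight (a : 'I_m -> nat) : 'I_m -> nat := fun i => a (rev_ord i).

Lemma rev_ord_le (i j : 'I_m) : (i <= j)%N -> (rev_ord j <= rev_ord i)%N.
Proof. by move=> ij; apply: leq_sub2l. Qed.

Section FlagDuality.
Variable k : 'I_m -> nat.

Lemma Psi_dim (x : flag R n k) i : \dim (perp (x (rev_ord i))) = dual_dims k i.
Proof. by rewrite dim_perp flag_dim. Qed.

Lemma Psi_incl (x : flag R n k) (i j : 'I_m) : (i <= j)%N ->
  (perp (x (rev_ord i)) <= perp (x (rev_ord j)))%VS.
Proof. by move=> ij; apply/perpS/flag_incl/rev_ord_le. Qed.

Definition Psi (x : flag R n k) : flag R n (dual_dims k) :=
  Flag (Psi_dim x) (@Psi_incl x).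

Variable k_len : forall i, (k i <= n)%N.

Lemma Psi_inv_dim (y : flag R n (dual_dims k)) i :
  \dim (perp (y (rev_ord i))) = k i.
Proof. by rewrite dim_perp flag_dim /dual_dims rev_ordK subKn. Qed.

Lemma Psi_inv_incl (y : flag R n (dual_dims k)) (i j : 'I_m) : (i <= j)%N ->
  (perp (y (rev_ord i)) <= perp (y (rev_ord j)))%VS.
Proof. by move=> ij; apply/perpS/flag_incl/rev_ord_le. Qed.

Definition Psi_inv (y : flag R n (dual_dims k)) : flag R n k :=
  Flag (Psi_inv_dim y) (@Psi_inv_incl y).

Lemma PsiK : cancel Psi Psi_inv.
Proof. by move=> x; apply: flag_eq => i /=; rewrite perpK rev_ordK. Qed.

Lemma Psi_invK : cancel Psi_inv Psi.
Proof. by move=> y; apply: flag_eq => i /=; rewrite perpK rev_ordK. Qed.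

End FlagDuality.

Definition std_vec (i : 'I_n) : Cn := delta_mx i 0.

(* theta_I as a form of degree d, for #|I| = d: the wedge product of the
   coordinate forms with indices in I, in increasing order. *)
Definition theta (d : nat) (I : {set 'I_n}) (v : 'I_d -> Cn) : C :=
  \det (\matrix_(c < d, e < d) [seq v e i 0 | i <- enum I]`_c).

Definition shuffle_sign (I : {set 'I_n}) : C :=
  if [pick s : 'S_n | [seq s i | i <- enum 'I_n] == enum I ++ enum (~: I)]
    is Some s then (-1) ^+ s else 0.

(* The linear extension of theta_I |-> sgn(I, J) theta_J: the coefficient of
   theta_I in tau is the value of tau at the standard basis vectors with
   indices in I. *)
Definition hodge_star (d : nat) (tau : ('I_d -> Cn) -> C) :
    ('I_(n - d) -> Cn) -> C :=
  fun w => \sum_(I : {set 'I_n} | #|I| == d)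
    tau (fun c => [seq std_vec i | i <- enum I]`_c) * shuffle_sign I *
      theta (~: I) w.

Section BundleMap.
Variable k : 'I_m -> nat.

(* The tensor product of the restrictions to x of the forms tau i j, j < p i. *)
Definition pure_tensor k' (p : 'I_m -> nat) (x : flag R n k')
    (tau : forall i : 'I_m, nat -> ('I_(k' i) -> Cn) -> C) : args x -> C :=
  fun v => \prod_i \prod_(j < p i) tau i j (fun c => vsval (v i j c)).

(* The Hodge duals of the forms tau i j, with the total order of the factors
   (lexicographic in (i, j)) reversed. *)
Definition dual_factors (p : 'I_m -> nat)
    (tau : forall i : 'I_m, nat -> ('I_(k i) -> Cn) -> C) :
    forall i : 'I_m, nat -> ('I_(dual_dims k i) -> Cn) -> C :=
  fun i j => hodge_star (tau (rev_ord i) (p (rev_ord i) - j.+1)%N).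

Definition is_hatPsi (p : 'I_m -> nat) (x : flag R n k)
    (F : (args x -> C) -> (args (Psi x) -> C)) : Prop :=
  (forall (b : C) (phi psi : args x -> C), in_fibre p phi -> in_fibre p psi ->
     F (fun v => b * phi v + psi v) = fun w => b * F phi w + F psi w) /\
  (forall tau : forall i : 'I_m, nat -> ('I_(k i) -> Cn) -> C,
     (forall i j, altform (tau i j)) ->
     F (pure_tensor p tau) = pure_tensor (dual_weight p) (dual_factors p tau)).

(* Every element of the fibre is a multiple of a pure tensor of restrictions,
   so is_hatPsi determines the map on the fibre. *)
Definition hatPsi (p : 'I_m -> nat) (x : flag R n k) :
    (args x -> C) -> (args (Psi x) -> C) :=
  xget (fun _ _ => 0) [set F | is_hatPsi p F].

(* Psi (Psi_inv y) is only propositionally equal to y, hence the retyping of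
   the vectors of v by vsproj. *)
Definition tildePsi (k_len : forall i, (k i <= n)%N) (p : 'I_m -> nat)
    (s : bsection R n k) : bsection R n (dual_dims k) :=
  fun y v => hatPsi p (s (Psi_inv k_len y))
    (fun i j c => vsproj (Psi (Psi_inv k_len y) i) (vsval (v i j c))).

End BundleMap.
End Duality.

(* Main.v *)
Require Import Defs.
From HB Require Import structures.
From mathcomp Require Import fingroup perm.
From mathcomp Require Import all_boot all_order all_algebra.
From mathcomp Require Import ring zify.
From mathcomp Require Import complex.
From mathcomp Require Import boolp classical_sets functions reals topology.
From mathcomp Require Import normedtype derive.

(* Idea. Let g be invertible, let x_d and q be its first d and its last n - d
   columns, and let w consist of n - d vectors orthogonal to the columns in x_d.
   For every alternating d-form tau,
     ( *tau)(w) = tau(x_d) det(q^T w) / det g.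
   Indeed the coefficient of theta_I in tau contributes det [e_I | w] to the
   left-hand side, and g^T [e_I | w] is block triangular. Hence, if g frames the
   flag x (its first columns span the subspaces), hatPsi at x multiplies the
   value at the frame by factors det(q^T w) / det g. From this formula
   one reads off that tildePsi is multiplicative; that it preserves holomorphy,
   because the inverse transpose of g with reversed columns frames Psi x; that
   it exchanges the characters r and |a| - r, because a torus element z
   multiplies det g by det z; and that applying it twice gives a nonzero
   constant, hence that it is bijective. *)

Set Implicit Arguments.
Unset Strict Implicit.
Unset Printing Implicit Defensive.

Import Order.TTheory GRing.Theory Num.Theory numFieldNormedType.Exports.
Local Open Scope ring_scope.

(** * Functoriality of Proj *)

Section ProjFunctoriality.
Local Open Scope classical_set_scope.
Local Open Scope quotient_scope.
Variable K : comPzRingType.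

Lemma proj_point_eq (A : gradedAlg K) (P Q : proj_point A) :
  (forall f, P f <-> Q f) -> P = Q.
Proof.
case: P Q => [P p1 p2 p3 p4 p5 p6 p7] [Q q1 q2 q3 q4 q5 q6 q7] /= PQ.
have e : P = Q by apply/funext => f; apply/propext.
by subst Q; congr ProjPoint; apply: Prop_irrelevance.
Qed.

Lemma graded_iso_sym (A B : gradedAlg K) (Phi : graded_iso A B) :
  exists Psi : graded_iso B A, cancel Phi Psi /\ cancel Psi Phi.
Proof.
have [inv PhiK invK] := giso_bij Phi.
have invZ : zmod_morphism inv.
  by move=> f g; apply: (can_inj PhiK); rewrite rmorphB /= !invK.
have invM : monoid_morphism inv.
  split=> [|f g]; apply: (can_inj PhiK); first by rewrite invK rmorph1.
  by rewrite rmorphM /= !invK.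
pose inv' := HB.pack_for {rmorphism B -> A} inv
  (GRing.isZmodMorphism.Build _ _ inv invZ)
  (GRing.isMonoidMorphism.Build _ _ inv invM).
have invb : bijective inv' by exists Phi.
have invc c : inv' (gaConst B c) = gaConst A c.
  by rewrite -(giso_const Phi) /= PhiK.
have invp N f : piece B N f <-> piece A N (inv' f).
  by rewrite (giso_piece Phi) /= invK.
by exists (GradedIso invb invc invp).
Qed.

Section Point.
Variables (A B : gradedAlg K) (Phi : graded_iso A B).

(** The witness is the preimage of [P] under the inverse of [Phi]. Membership is stated through
    [Phi] alone, which determines the point since [Phi] is surjective. *)
Lemma giso_point (P : proj_point A) :
  {Q : proj_point B | forall f, Q (Phi f) <-> P f}.
Proof.
apply: cid; have [Psi [PhiK PsiK]] := graded_iso_sym Phi.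
have h0 : P (Psi 0) by rewrite rmorph0; apply: pideal0.
have hD f g : P (Psi f) -> P (Psi g) -> P (Psi (f + g)).
  by rewrite rmorphD; apply: pidealD.
have hM f g : P (Psi g) -> P (Psi (f * g)) by rewrite rmorphM; apply: pidealM.
have hh f : P (Psi f) -> exists (d : nat) (h : nat -> B),
    (forall N, piece B N (h N) /\ P (Psi (h N))) /\ f = \sum_(N < d) h N.
  move=> /pideal_homogeneous[d [h [hh e]]]; exists d, (Phi \o h); split=> [N|].
    rewrite /= PhiK; have [hN ?] := hh N; split=> //.
    exact: (giso_piece Phi _ _).1.
  by rewrite -[f]PsiK e rmorph_sum.
have h1 : ~ P (Psi 1) by rewrite rmorph1; apply: pideal_proper.
have hp f g : P (Psi (f * g)) -> P (Psi f) \/ P (Psi g).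
  by rewrite rmorphM; apply: pideal_prime.
have hr : exists N (f : B), [/\ (0 < N)%N, piece B N f & ~ P (Psi f)].
  have [N [f [N0 fN nf]]] := pideal_relevant P.
  by exists N, (Phi f); split; rewrite ?PhiK //; apply: (giso_piece Phi _ _).1.
exists (@ProjPoint _ B (fun b => P (Psi b)) h0 hD hM hh h1 hp hr) => f /=.
by rewrite PhiK.
Qed.

Definition proj_map (P : proj_point A) : proj_point B := sval (giso_point P).

Lemma proj_mapE P f : proj_map P (Phi f) <-> P f.
Proof. exact: (svalP (giso_point P)). Qed.

Section Germ.
Variables (P : proj_point A) (Q : proj_point B).
Hypothesis PQ : forall f, Q (Phi f) <-> P f.

Lemma hfrac_map_notin (x : hfrac P) : ~ Q (Phi (hden x)).
Proof. by move/PQ; apply: hden_notin. Qed.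

(** The target is any [Q] that corresponds to [P], not only [proj_map Phi P]. The inverse map of
    germs then lands at [P] itself, without transport along [proj_map Psi (proj_map Phi P) = P]. *)
Definition hfrac_map (x : hfrac P) : hfrac Q :=
  HFrac ((giso_piece Phi _ _).1 (hnum_deg x))
    ((giso_piece Phi _ _).1 (hden_deg x)) (@hfrac_map_notin x).

Definition hloc_map (x : hloc P) : hloc Q := \pi_(hloc Q) (hfrac_map (repr x)).

Lemma hloc_map_pi x : hloc_map (\pi_(hloc P) x) = \pi_(hloc Q) (hfrac_map x).
Proof.
have /hloc_eqP[N [h [hN nh e]]] := reprK (\pi_(hloc P) x).
apply: hlocP; exists N, (Phi h); split; first exact: (giso_piece Phi _ _).1.
  by move/PQ.
by rewrite /= -!rmorphM -rmorphB -rmorphM e rmorph0.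
Qed.

Lemma hloc_mapB : zmod_morphism hloc_map.
Proof.
elim/quotW=> x; elim/quotW=> y.
have -> : (\pi_(hloc P) x : hloc P) - (\pi_(hloc P) y : hloc P) =
    \pi_(hloc P) (hfracD x (hfracN y)).
  by rewrite [- _]hlocN_pi [LHS]hlocD_pi.
rewrite !hloc_map_pi [- _]hlocN_pi [RHS]hlocD_pi.
by apply: hlocP1; rewrite /= rmorphD !rmorphM rmorphN.
Qed.

Lemma hloc_mapM : monoid_morphism hloc_map.
Proof.
split; first by rewrite [LHS]hloc_map_pi; apply: hlocP1; rewrite /= rmorph1.
elim/quotW=> x; elim/quotW=> y; rewrite [_ * _]hlocM_pi !hloc_map_pi.
by rewrite [RHS]hlocM_pi; apply: hlocP1; rewrite /= !rmorphM.
Qed.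

End Germ.

Lemma proj_map_continuous : continuous proj_map.
Proof.
apply/continuousP => V [S [hS eV]].
exists [set f | S (Phi f)]; split=> [f /hS[N fN]|P].
  by exists N; apply: (giso_piece Phi _ _).2.
rewrite [(_ @^-1` _) P]/= eV; split=> n h; apply: n.
  have [Psi [PhiK PsiK]] := graded_iso_sym Phi.
  by move=> f Sf; rewrite -[f]PsiK; apply/proj_mapE/h; rewrite /= PsiK.
by move=> f /h /proj_mapE.
Qed.

End Point.

Lemma proj_mapK (A B : gradedAlg K) (Phi : graded_iso A B)
    (Psi : graded_iso B A) : cancel Phi Psi -> cancel (proj_map Phi) (proj_map Psi).
Proof.
move=> PhiK P; apply: proj_point_eq => f.
by rewrite -{1}[f]PhiK proj_mapE proj_mapE.
Qed.

Section Sheaf.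
Variables (A B : gradedAlg K) (Phi : graded_iso A B) (Psi : graded_iso B A).
Hypotheses (PhiK : cancel Phi Psi) (PsiK : cancel Psi Phi).

Lemma proj_map_sym (P : proj_point A) f : P (Psi f) <-> proj_map Phi P f.
Proof. by rewrite -{2}[f]PsiK proj_mapE. Qed.

Lemma hloc_mapK (P : proj_point A) (Q : proj_point B)
    (PQ : forall f, Q (Phi f) <-> P f) (QP : forall f, P (Psi f) <-> Q f) x :
  hloc_map QP (hloc_map PQ x) = x.
Proof.
move: x; elim/quotW=> x; rewrite (hloc_map_pi PQ) (hloc_map_pi QP).
by apply: hlocP1; rewrite /= !PhiK.
Qed.

Section Open.
Variables (U : set (proj_point A)) (V : set (proj_point B)).
Hypothesis UV : U = proj_map Phi @^-1` V.

Lemma UV_map P : U P -> V (proj_map Phi P).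
Proof. by rewrite UV. Qed.

Lemma pullback_fraction (s : ringSections V) : locally_fraction (fun P (UP : U P) =>
  hloc_map (proj_map_sym P) (s (proj_map Phi P) (UV_map UP))).
Proof.
move=> P UP.
have [W [oW WP [N [f [g [fN [gN h]]]]]]] := rsvalP s (UV_map UP).
exists (proj_map Phi @^-1` W); split=> //.
  by move/continuousP: (@proj_map_continuous A B Phi); apply.
exists N, (Psi f), (Psi g), ((giso_piece Psi _ _).1 fN), ((giso_piece Psi _ _).1 gN).
move=> Q UQ WQ; have [ng e] := h _ (UV_map UQ) WQ.
have ng' : ~ Q (Psi g) by move/(proj_map_sym Q).
by exists ng'; rewrite e hloc_map_pi; apply: hlocP1.
Qed.

(** [U] is only assumed equal to the preimage of [V]. The same construction with [Phi] and [Psi]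
    exchanged therefore gives a map back to the sections over [V]. *)
Definition pullback (s : ringSections V) : ringSections U :=
  RingSection (pullback_fraction s).

Lemma pullbackB : zmod_morphism pullback.
Proof. by move=> s t; apply: ringSection_eq => P UP; apply: hloc_mapB. Qed.

Lemma pullbackM : monoid_morphism pullback.
Proof.
by split=> [|s t]; apply: ringSection_eq => P UP;
  have [h1 hM] := hloc_mapM (proj_map_sym P); [apply: h1|apply: hM].
Qed.

HB.instance Definition _ :=
  GRing.isZmodMorphism.Build (ringSections V) (ringSections U) pullback pullbackB.
HB.instance Definition _ :=
  GRing.isMonoidMorphism.Build (ringSections V) (ringSections U) pullback pullbackM.

Definition pullback_rmorphism : {rmorphism ringSections V -> ringSections U} :=
  pullback.
End Open.
End Sheaf.

(** The values of [s] at equal points have different types; they are compared after both are mapped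
    to the germs at a common [T]. *)
Lemma rsval_irr (A : gradedAlg K) U (s : ringSections U) (P Q : proj_point A)
    (B : gradedAlg K) (Phi : graded_iso A B) (T : proj_point B)
    (UP : U P) (UQ : U Q) (PT : forall f, T (Phi f) <-> P f)
    (QT : forall f, T (Phi f) <-> Q f) :
  P = Q -> hloc_map PT (s P UP) = hloc_map QT (s Q UQ).
Proof.
move=> e; subst Q; rewrite (Prop_irrelevance UP UQ).
by rewrite (Prop_irrelevance PT QT).
Qed.

Lemma pullback_cancel (A B : gradedAlg K) (Phi : graded_iso A B)
    (Psi : graded_iso B A) (PhiK : cancel Phi Psi) (PsiK : cancel Psi Phi)
    (U : set (proj_point A)) (V : set (proj_point B))
    (UV : U = proj_map Phi @^-1` V) (VU : V = proj_map Psi @^-1` U) :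
  cancel (pullback PsiK UV) (pullback PhiK VU).
Proof.
move=> s; apply: ringSection_eq => Q VQ /=.
set P := proj_map Psi Q.
have PQ f : Q (Phi f) <-> P f by exact: proj_map_sym.
have QP f : P (Psi f) <-> Q f by exact: proj_mapE.
(* The value of [s] at [Q] is sent to the germs at [P] and back, so that it can be compared there
   with the value at [proj_map Phi P]. *)
rewrite -[RHS](hloc_mapK PsiK QP PQ).
rewrite (Prop_irrelevance (proj_map_sym PhiK Q) PQ); congr hloc_map.
by apply: rsval_irr; apply: proj_mapK.
Qed.

Lemma Proj_iso (A B : gradedAlg K) (Phi : graded_iso A B) :
  exists F : ringed_iso (Proj A) (Proj B), induced_by Phi F.
Proof.
have [Psi [PhiK PsiK]] := graded_iso_sym Phi.
pose sheaf (V : set (Proj B)) (oV : open V) :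
  {rmorphism rs_ring V -> rs_ring (proj_map Phi @^-1` V : set (Proj A))} :=
  pullback_rmorphism PsiK (erefl (proj_map Phi @^-1` V)).
have sheaf_bij (V : set (Proj B)) (oV : open V) : bijective (sheaf V oV).
  have VU : V = proj_map Psi @^-1` (proj_map Phi @^-1` V).
    by apply/seteqP; split=> Q /=; rewrite proj_mapK.
  exists (pullback PhiK VU).
    exact: (pullback_cancel PhiK PsiK erefl VU).
  exact: (pullback_cancel PsiK PhiK VU erefl).
have sheaf_restrict (V W : set (Proj B)) (oV : open V) (oW : open W)
    (WV : W `<=` V) (s : rs_ring V) :
    sheaf W oW (rs_restrict WV s) =
    rs_restrict (preimage_subset WV) (sheaf V oV s).
  apply: ringSection_eq => P WP /=; congr hloc_map; congr (rsval s _).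
  exact: Prop_irrelevance.
exists (@RingedIso (Proj A) (Proj B) (proj_map Phi) (proj_map Psi)
  (proj_mapK PhiK) (proj_mapK PsiK) (@proj_map_continuous A B Phi)
  (@proj_map_continuous B A Psi) sheaf sheaf_bij sheaf_restrict).
split=> [P f|V oV s P VP x y ey ex /=]; first exact: proj_mapE.
rewrite (Prop_irrelevance (UV_map erefl VP) VP).
have PQ := proj_mapE Phi P; have QP := proj_map_sym PsiK P.
(* The hypotheses on [y] say that its class is the image of that of [x]. Both implications follow
   because the two maps of germs are inverse to each other. *)
have ey' : hloc_map PQ (\pi_(hloc P) x) = \pi_(hloc (proj_map Phi P)) y.
  by rewrite hloc_map_pi; apply: hlocP1; rewrite /= ey ex mulrC.
rewrite -ey' (Prop_irrelevance (proj_map_sym _ _) QP).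
split=> [<-|->]; first by rewrite (hloc_mapK PsiK).
by rewrite (hloc_mapK PhiK).
Qed.

End ProjFunctoriality.

(** * The Hodge star of a form on vectors orthogonal to part of a frame *)

Section Multilinear.
Variables (F : fieldType) (V : lmodType F) (k : nat).

(** Unlike in [multilinear_eq0], the number [q] of spanning vectors is independent of the degree:
    below, d-forms are tested on the [n] standard vectors. The arguments are expanded one at a time,
    starting with the last. *)
Lemma multilinear_spanE (q : nat) (e : 'I_q -> V) (H : ('I_k -> V) -> F) :
  (forall v, exists M : 'I_q -> F, v = \sum_d M d *: e d) ->
  multilinear H -> (forall g : 'I_k -> 'I_q, H (e \o g) = 0) ->
  forall u, H u = 0.
Proof.
move=> span_e Hl He.
have H0 u c : H (set_arg u c 0) = 0.
  have := Hl u c (-1) 0 0; rewrite scaler0 addr0 mulN1r.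
  by move->; rewrite addNr.
have P t : forall u, (forall c : 'I_k, (t <= c)%N -> exists d, u c = e d) ->
    H u = 0.
  elim: t => [|t IH] u ub.
    have /choice[g ug] : forall c, exists d, u c = e d by move=> c; apply: ub.
    by rewrite -(He g); congr (H _); apply/funext.
  have [tk|kt] := ltnP t k; last first.
    by apply: IH => c /(leq_trans kt); rewrite leqNgt ltn_ord.
  pose c := Ordinal tk; have [M uM] := span_e (u c).
  rewrite -[u](set_arg_same u c) uM.
  elim/big_rec: _ => // d v _ hv; rewrite Hl hv addr0 IH ?mulr0 // => c' tc'.
  rewrite set_argE; case: eqVneq => [_|ne]; first by exists d.
  apply: ub; rewrite ltn_neqAle tc' andbT; apply: contra ne => /eqP e'.
  by apply/eqP/val_inj.
by move=> u; apply: (P k) => c; rewrite leqNgt ltn_ord.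
Qed.

Lemma multilinear_det (B : 'I_k -> V -> F) :
  (forall a, linear_for *%R (B a)) ->
  multilinear (fun u : 'I_k -> V => \det (\matrix_(b, a) B a (u b))).
Proof.
move=> Bl u c a v w; rewrite /= -[X in _ = _ + X]mul1r.
apply: (determinant_multilinear (i0 := c)).
- by apply/rowP=> d; rewrite !mxE !set_argE eqxx Bl mul1r.
- by apply/matrixP=> i j; rewrite !mxE !set_argE eq_sym (negbTE (neq_lift _ _)).
- by apply/matrixP=> i j; rewrite !mxE !set_argE eq_sym (negbTE (neq_lift _ _)).
Qed.

Lemma altform_det (B : 'I_k -> V -> F) :
  (forall a, linear_for *%R (B a)) ->
  altform (fun u : 'I_k -> V => \det (\matrix_(b, a) B a (u b))).
Proof.
move=> Bl; split; first exact: multilinear_det.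
by move=> u c d ne e; apply: (determinant_alternate ne) => a; rewrite !mxE e.
Qed.

Lemma altformZ (c : F) (f : ('I_k -> V) -> F) :
  altform f -> altform (fun u => c * f u).
Proof.
move=> [fl fa]; split=> [u d a v w|u d d' ne e]; last by rewrite (fa _ d d') ?mulr0.
by rewrite fl mulrDr mulrCA.
Qed.

Lemma altform_comp (W : lmodType F) (h : {linear W -> V}) (f : ('I_k -> V) -> F) :
  altform f -> altform (fun u => f (h \o u)).
Proof.
move=> [fl fa]; split=> [u c a v w|u c d ne e]; last first.
  by apply: (fa _ c d) => //=; rewrite e.
have hs x : h \o set_arg u c x = set_arg (h \o u) c (h x).
  by apply/funext => d; rewrite /= !set_argE; case: eqP.
by rewrite !hs linearP fl.
Qed.

End Multilinear.

(** The casts leave [A] in size [n], which in the application equals [d + (n - d)] only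
    propositionally. *)
Lemma det_nat_block (F : fieldType) (n d e : nat) (E : (d + e)%N = n) (A : 'M[F]_n) :
  (forall i j, A (cast_ord E (lshift e i)) (cast_ord E (rshift d j)) = 0) ->
  \det A = \det (\matrix_(i < d, j < d)
                    A (cast_ord E (lshift e i)) (cast_ord E (lshift e j))) *
           \det (\matrix_(i < e, j < e)
                    A (cast_ord E (rshift d i)) (cast_ord E (rshift d j))).
Proof.
subst n => A0; rewrite -{1}[A]submxK (_ : ursubmx A = 0).
  rewrite det_lblock; congr (_ * _); congr (\det _); apply/matrixP=> i j;
    by rewrite !mxE; congr (A _ _); apply: val_inj.
by apply/matrixP=> i j; rewrite !mxE -[RHS](A0 i j); congr (A _ _); apply: val_inj.
Qed.

Lemma det_nat_block_tr (F : fieldType) (n d e : nat) (E : (d + e)%N = n)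
    (A : 'M[F]_n) :
  (forall i j, A (cast_ord E (rshift d j)) (cast_ord E (lshift e i)) = 0) ->
  \det A = \det (\matrix_(i < d, j < d)
                    A (cast_ord E (lshift e i)) (cast_ord E (lshift e j))) *
           \det (\matrix_(i < e, j < e)
                    A (cast_ord E (rshift d i)) (cast_ord E (rshift d j))).
Proof.
move=> A0; rewrite -det_tr (det_nat_block (E := E)) => [|i j]; last by rewrite mxE.
by congr (_ * _); rewrite -[RHS]det_tr; congr (\det _); apply/matrixP=> i j;
  rewrite !mxE.
Qed.

Section Hodge.
Variables (R : realType) (n : nat).
Local Notation C := R[i].
Local Notation Cn := 'cV[R[i]]_n.

Lemma columns_nth (g : 'M[C]_n) (i : 'I_n) : (columns g)`_i = col i g.
Proof.
by rewrite (nth_map i) ?size_enum_ord ?ltn_ord // nth_ord_enum.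
Qed.

Lemma colvec_sum (v : Cn) : v = \sum_i v i 0 *: std_vec R i.
Proof.
by rewrite {1}[v]matrix_sum_delta; apply: eq_bigr => i _; rewrite big_ord1.
Qed.

Lemma nth_enum_set (I : {set 'I_n}) d : #|I| = d -> forall (x : 'I_n) c,
  (c < d)%N -> nth x (enum I) c \in I.
Proof. by move=> <- x c cd; rewrite -mem_enum mem_nth // -cardE. Qed.

(** Both sides are multilinear, so standard vectors suffice as arguments. If an index is repeated
    both sides vanish; otherwise only the set of the indices that occur contributes. *)
Lemma altform_theta d (tau : ('I_d -> Cn) -> C) : altform tau ->
  forall u, tau u = \sum_(I : {set 'I_n} | #|I| == d)
    tau (fun c => [seq std_vec R i | i <- enum I]`_c) * theta I u.
Proof.
move=> tauP u; apply/eqP; rewrite -subr_eq0; apply/eqP.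
pose H u := tau u - \sum_(I : {set 'I_n} | #|I| == d)
    tau (fun c => [seq std_vec R i | i <- enum I]`_c) * theta I u.
have thetaP (I : {set 'I_n}) : #|I| == d -> altform (@theta R n d I).
  move=> /eqP Id.
  suff -> : @theta R n d I = fun u : 'I_d -> Cn =>
      \det (\matrix_(b, a) [seq u b i 0 | i <- enum I]`_a).
    apply: (altform_det (B := fun a (v : Cn) => [seq v i 0 | i <- enum I]`_a)).
    move=> a c v w; case: (ltnP a (size (enum I))) => la.
      have i0 : 'I_n by case: (enum I) la => [|x s].
      by rewrite !(nth_map i0) // !mxE.
    by rewrite !nth_default ?size_map // mulr0 addr0.
  apply/funext => v; rewrite /theta -det_tr; congr (\det _).
  by apply/matrixP=> a b; rewrite !mxE.
rewrite -/(H u); apply: (@multilinear_spanE _ _ _ n (@std_vec R n)).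
- by move=> v; exists (fun i => v i 0); apply: colvec_sum.
- move=> {}u c a v w; rewrite /H tauP.1.
  under eq_bigr => I /thetaP[thl _] do rewrite thl mulrDr mulrCA.
  by rewrite big_split -mulr_sumr /=; ring.
move=> g; rewrite /H; have [ig|] := boolP (injectiveb g); last first.
  move=> /injectivePn[c [c' ne gcd]].
  rewrite (tauP.2 _ c c') //=; last by rewrite gcd.
  rewrite big1 ?subr0 // => I /thetaP[_ +].
  by move=> /(_ _ c c' ne) ->; rewrite ?mulr0 //= gcd.
move/injectiveP: ig => ig; pose I0 := [set g c | c : 'I_d].
have I0d : #|I0| = d by rewrite card_imset // card_ord.
have mem0 c : g c \in enum I0 by rewrite mem_enum imset_f.
have sz0 : size (enum I0) = d by rewrite -cardE.
have gi c : (index (g c) (enum I0) < d)%N by rewrite -[X in (_ < X)%N]sz0 index_mem.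
(* The sorting permutation of [g]: the position of [g c] in the increasing enumeration of [I0]. *)
pose s0 c : 'I_d := Ordinal (gi c).
have s0i : injective s0.
  move=> c c' /(congr1 val) /= e; apply: ig.
  by rewrite -[g c](nth_index (g c) (mem0 c)) e nth_index.
pose s := perm s0i.
have nth0 c x : nth x (enum I0) (s c) = g c by rewrite permE /= nth_index.
rewrite (bigD1 I0) ?I0d //= [X in _ - (_ + X)]big1 ?addr0; last first.
  move=> I /andP[/eqP Id ne].
  have [c cI] : exists c : 'I_d, g c \notin I.
    apply/existsP; rewrite -[X in is_true X]negbK; apply: contra ne => h.
    have sub : I0 \subset I.
      apply/fintype.subsetP => _ /imsetP[c _ ->].
      by move: h => /existsPn/(_ c); rewrite negbK.
    by rewrite eq_sym eqEcard sub Id I0d /=.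
  (* As [g c] lies outside [I], the coordinates of its standard vector with indices in [I] are all
     zero, so the transposed matrix has a zero row. *)
  rewrite /theta -det_tr (expand_det_row _ c) big1 ?mulr0 // => a _.
  rewrite !mxE (nth_map (g c)) -?cardE ?Id ?ltn_ord // mxE.
  case: eqP => [e|_]; last by rewrite mul0r.
  by case/negP: cI; rewrite -e; apply: (nth_enum_set Id); apply: ltn_ord.
have -> : theta I0 (@std_vec R n \o g) = (-1) ^+ s :> C.
  rewrite /theta -det_perm -[RHS]det_tr; congr (\det _); apply/matrixP=> a c.
  rewrite !mxE (nth_map (g c)) ?sz0 ?ltn_ord // mxE andbT.
  congr (_ %:R); congr nat_of_bool; rewrite -[X in _ == X](nth0 c (g c)).
  by rewrite nth_uniq ?sz0 ?ltn_ord ?enum_uniq // eq_sym -val_eqE.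
pose e0 (c : 'I_d) : Cn := [seq std_vec R i | i <- enum I0]`_c.
have -> : @std_vec R n \o g = e0 \o s.
  apply/funext => c; rewrite /e0 /= (nth_map (g c)) ?sz0 ?ltn_ord //.
  by rewrite nth0.
by rewrite altform_perm // mulrC subrr.
Qed.

(** The factor det(q^T w) / det g, with q the columns of [g] from index [d] on. The number [e] of
    vectors is free because it occurs both as [n - d] and as an entry of a dimension vector [l]. *)
Definition dual_ratio (g : 'M[C]_n) (d e : nat) (w : 'I_e -> Cn) : C :=
  \det (\matrix_(a < e, b < e) bform (columns g)`_(d + a) (w b)) / \det g.

(* The matrix [N] below is [e_I | w]: permuting its rows gives the left-hand
   side, and [g^T *m N] is block triangular. *)
Lemma theta_dual_ratio (g : 'M[C]_n) d (I : {set 'I_n}) (w : 'I_(n - d) -> Cn) :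
  g \in unitmx -> (d <= n)%N -> #|I| = d ->
  (forall (c : 'I_d) b, bform (columns g)`_c (w b) = 0) ->
  shuffle_sign R I * theta (~: I) w =
  theta I (fun c : 'I_d => (columns g)`_c) * dual_ratio g d w.
Proof.
move=> gu dn Id ort; have E := subnKC dn.
have szI : size (enum I) = d by rewrite -cardE.
have szIc : size (enum (~: I)) = (n - d)%N.
  by rewrite -cardE cardsCs finset.setCK card_ord Id.
pose ls := enum I ++ enum (~: I).
have lsz : size ls = n by rewrite size_cat szI szIc.
have lsu : uniq ls.
  rewrite cat_uniq !enum_uniq andbT /=; apply/hasPn => x.
  by rewrite !mem_enum inE.
pose s0 (i : 'I_n) := nth i ls i.
have s0E (i j : 'I_n) : nth j ls i = s0 i.
  by apply: set_nth_default; rewrite lsz.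
have s0i : injective s0.
  move=> i j; rewrite -(s0E i j) /s0 => /eqP.
  by rewrite nth_uniq ?lsz ?ltn_ord // => /eqP/val_inj.
have s0sz : size [seq s0 i | i <- enum 'I_n] = n.
  by rewrite size_map size_enum_ord.
have s0map : [seq s0 i | i <- enum 'I_n] = ls.
  case: (posnP n) => [n0|n0].
    have -> : ls = [::] by apply: size0nil; rewrite lsz.
    by apply: size0nil; rewrite s0sz.
  apply: (@eq_from_nth _ (Ordinal n0)); rewrite s0sz ?lsz // => i ilt.
  rewrite (nth_map (Ordinal n0)) ?size_enum_ord //.
  by rewrite [nth _ _ i](nth_ord_enum _ (Ordinal ilt)) -(s0E _ (Ordinal n0)).
(* The permutation [perm s0i] satisfies the condition of [pick], so the default value 0 does not
   arise. *)
rewrite /shuffle_sign; case: pickP => [s /eqP ss|]; last first.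
  move/(_ (perm s0i)); rewrite (eq_map (permE s0i)) s0map eqxx //.
have sE (i : 'I_n) x : nth x ls i = s i.
  by rewrite /ls -ss (nth_map i) ?size_enum_ord // nth_ord_enum.
pose N : 'M[C]_n := \matrix_(i, j)
  match fintype.split (cast_ord (esym E) j) with
  | inl c => (i == s (cast_ord E (lshift (n - d) c)))%:R
  | inr b => w b i 0 end.
have NL i c : N i (cast_ord E (lshift (n - d) c)) =
    (i == s (cast_ord E (lshift (n - d) c)))%:R.
  rewrite mxE cast_ordK; case: fintype.splitP => [c' /= ec|b /= eb].
    by congr ((i == s _)%:R); apply: val_inj.
  by have := ltn_ord c; rewrite eb ltnNge leq_addr.
have NR i b : N i (cast_ord E (rshift d b)) = w b i 0.
  rewrite mxE cast_ordK; case: fintype.splitP => [c' /= ec|b' /= /addnI eb].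
    by have := ltn_ord c'; rewrite -ec ltnNge leq_addr.
  by congr (w _ i 0); apply: val_inj.
have sL c x : s (cast_ord E (lshift (n - d) c)) = nth x (enum I) c.
  by rewrite -(sE _ x) /= nth_cat szI ltn_ord.
have sR b x : s (cast_ord E (rshift d b)) = nth x (enum (~: I)) b.
  by rewrite -(sE _ x) /= nth_cat szI ltnNge leq_addr /= addKn.
have i0 (c : 'I_d) : 'I_n by exact: (cast_ord E (lshift (n - d) c)).
have i1 (b : 'I_(n - d)) : 'I_n by exact: (cast_ord E (rshift d b)).
have detN : \det N = (-1) ^+ s * theta (~: I) w.
  (* [row_perm s N] lists the rows with index in [I] first. It is block triangular, with an identity
     block and the block of the rows of [w] outside [I]. *)
  have -> : N = row_perm (s^-1)%g (row_perm s N).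
    by apply/matrixP=> i j; rewrite !mxE permKV.
  rewrite row_permE det_mulmx det_perm odd_permV; congr (_ * _).
  rewrite (det_nat_block_tr (E := E)) => [|i j]; last first.
    rewrite [row_perm _ _ _ _]mxE NL; case: eqP => // /perm_inj /(congr1 val) /= e.
    by have := ltn_ord i; rewrite -e ltnNge leq_addr.
  rewrite (_ : \matrix_(i, j) _ = 1%:M) ?det1 ?mul1r; last first.
    apply/matrixP=> i j; rewrite mxE [row_perm _ _ _ _]mxE NL mxE; congr (_%:R).
    by rewrite (inj_eq (@perm_inj _ s)).
  rewrite /theta; congr (\det _); apply/matrixP=> i j.
  rewrite !mxE (nth_map (i1 i)) ?szIc // -(sR i).
  by rewrite cast_ordK; case: fintype.splitP => [c' /= ec|b' /= /addnI eb];
    [have := ltn_ord c'; rewrite -ec ltnNge leq_addr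
    |congr (w _ _ 0); apply: val_inj].
have colL (c : 'I_d) i :
    (columns g)`_(lshift (n - d) c) i 0 = g i (cast_ord E (lshift (n - d) c)).
  by rewrite -[nat_of_ord _]/(nat_of_ord (cast_ord E (lshift (n - d) c)))
    columns_nth mxE.
have colR (c : 'I_(n - d)) i :
    (columns g)`_(d + c)%N i 0 = g i (cast_ord E (rshift d c)).
  by rewrite -[(d + c)%N]/(nat_of_ord (cast_ord E (rshift d c))) columns_nth mxE.
have det2 : \det g * \det N = theta I (fun c : 'I_d => (columns g)`_c) *
    \det (\matrix_(a < n - d, b < n - d) bform (columns g)`_(d + a) (w b)).
  rewrite -(det_tr g) -det_mulmx (det_nat_block (E := E)) => [|c b]; last first.
    rewrite -[RHS](ort c b) mxE; apply: eq_bigr => i _.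
    by rewrite NR mxE -colL.
  congr (_ * _); last first.
    congr (\det _); apply/matrixP=> a b; rewrite !mxE; apply: eq_bigr => i _.
    by rewrite NR !mxE -colR.
  rewrite /theta -det_tr; congr (\det _); apply/matrixP=> a b.
  rewrite !mxE (nth_map (i0 a)) ?szI // -(sL a).
  rewrite (bigD1 (s (cast_ord E (lshift (n - d) a)))) //= NL eqxx mulr1 big1.
    by rewrite addr0 mxE -colL.
  by move=> i ne; rewrite NL (negbTE ne) mulr0.
have dg : \det g != 0 by rewrite -unitfE -unitmxE.
by rewrite -detN /dual_ratio mulrA -det2 mulrC mulKf.
Qed.

(** The ratio in [theta_dual_ratio] does not depend on [I], so it factors out of the expansion of
    [tau] at the first [d] columns. *)
Lemma hodge_star_ratio (g : 'M[C]_n) d (tau : ('I_d -> Cn) -> C)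
    (w : 'I_(n - d) -> Cn) :
  g \in unitmx -> (d <= n)%N -> altform tau ->
  (forall (c : 'I_d) b, bform (columns g)`_c (w b) = 0) ->
  hodge_star tau w = tau (fun c => (columns g)`_c) * dual_ratio g d w.
Proof.
move=> gu dn tauP ort.
rewrite /hodge_star (altform_theta tauP (fun c => _)) mulr_suml.
by apply: eq_bigr => I /eqP Id; rewrite -!mulrA (theta_dual_ratio gu dn Id ort).
Qed.

End Hodge.

(** * Frames of flags and the map hatPsi *)

Section Frames.
Variables (R : realType) (n m : nat).
Local Notation C := R[i].
Local Notation Cn := 'cV[R[i]]_n.

Lemma bform_linear (u : Cn) : linear_for *%R (bform u).
Proof.
move=> a v w; rewrite /bform mulr_sumr -big_split /=.
by apply: eq_bigr => i _; rewrite !mxE mulrDr mulrCA.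
Qed.

Lemma bformZl a (u v : Cn) : bform (a *: u) v = a * bform u v.
Proof. by rewrite mulr_sumr; apply: eq_bigr => i _; rewrite mxE mulrA. Qed.

Lemma size_columns (g : 'M[C]_n) : size (columns g) = n.
Proof. by rewrite size_map size_enum_ord. Qed.

Lemma free_columns (g : 'M[C]_n) : free (columns g) = (g \in unitmx).
Proof.
pose X := Tuple (introT eqP (size_columns g)).
have XE (v : 'rV[C]_n) : (v *m g^T == 0) = (\sum_i v 0 i *: X`_i == 0).
  rewrite -(inj_eq trmx_inj) trmx0 trmx_mul trmxK.
  congr (_ == 0); apply/colP => j; rewrite mxE summxE; apply: eq_bigr => i _.
  by rewrite [X`_i]columns_nth !mxE mulrC.
rewrite -unitmx_tr -row_free_unit -[columns g]/(tval X).
apply/freeP/idP => [h|gf c c0 i].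
  apply: inj_row_free => v /eqP; rewrite XE => /eqP v0.
  by apply/rowP => i; rewrite mxE (h _ v0).
have : (\row_i c i) *m g^T == 0.
  by rewrite XE -[X in _ == X]c0; apply/eqP/eq_bigr => i' _; rewrite mxE.
by rewrite mulmx_free_eq0 // => /eqP/rowP/(_ i); rewrite !mxE.
Qed.

Lemma free_extend (b : seq Cn) (V : {vspace Cn}) :
  free b -> (<<b>> <= V)%VS -> exists c, free (b ++ c) /\ <<b ++ c>>%VS = V.
Proof.
move=> fb bV; exists (vbasis (V :\: <<b>>)).
rewrite cat_free fb (basis_free (vbasisP _)) span_cat (span_basis (vbasisP _)) /=.
split; first by apply/directv_addP; rewrite capvC capv_diff.
by rewrite addvC addv_diff; apply/addv_idPl.
Qed.

(** A basis is extended along the flag: after [t] steps there is a free family with prefixes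
    spanning the first [t] subspaces, contained in all the later ones. At the end it is completed to
    a basis of the whole space. *)
Lemma frame_exists (k : 'I_m -> nat) (x : flag R n k) :
  exists g : 'M[C]_n, g \in unitmx /\ spanned_by x g.
Proof.
have chain t : (t <= m)%N -> exists b : seq Cn, [/\ free b,
    forall i : 'I_m, (i < t)%N -> x i = <<take (k i) b>>%VS &
    forall i : 'I_m, (t <= i)%N -> (<<b>> <= x i)%VS].
  elim: t => [_|t IH tm].
    by exists [::]; split=> // [|i _]; rewrite ?nil_free // span_nil sub0v.
  have [b [fb xb bx]] := IH (ltnW tm).
  have [c [fc bc]] := free_extend fb (bx (Ordinal tm) (leqnn t)).
  have sz : size (b ++ c) = k (Ordinal tm).
    by rewrite -(flag_dim x) -bc; apply/esym/eqP.
  exists (b ++ c); split=> // i; last first.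
    by move=> ti; rewrite bc; apply: flag_incl; apply: ltnW.
  rewrite ltnS leq_eqVlt => /predU1P[it|it].
    have -> : i = Ordinal tm by apply: val_inj.
    by rewrite -sz take_size.
  rewrite take_cat; have := xb i it; case: ltnP => // kb ->.
  (* [k i] is the dimension of a subspace spanned by [b], hence at most [size b], and no vector of
     [c] is taken. *)
  rewrite take_oversize //; have -> : (k i - size b = 0)%N.
    apply/eqP; rewrite subn_eq0 -(flag_dim x) xb // take_oversize //.
    exact: dim_span.
  by rewrite take0 cats0.
have [b [fb xb _]] := chain m (leqnn m).
have [c [fc bc]] := free_extend fb (subvf _).
have sz : size (b ++ c) = n.
  have /eqP <- : free (b ++ c) by [].
  by rewrite bc dimvf /dim /= muln1.
pose g : 'M[C]_n := \matrix_(i, j) (b ++ c)`_j i 0.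
have gE : columns g = b ++ c.
  apply: (@eq_from_nth _ 0); rewrite size_columns ?sz // => i ni.
  rewrite (columns_nth g (Ordinal ni) : (columns g)`_i = _).
  by apply/colP => j; rewrite !mxE.
exists g; split; first by rewrite -free_columns gE.
  move=> i; rewrite gE take_cat xb //; case: ltnP => // kb.
  rewrite take_oversize //; have -> : (k i - size b = 0)%N.
    apply/eqP; rewrite subn_eq0 -(flag_dim x) xb // take_oversize //.
    exact: dim_span.
  by rewrite take0 cats0.
Qed.
End Frames.

(** * Elements of a fibre evaluated at a frame, and the formula for [hatPsi] *)

Section Fibres.
Variables (R : realType) (n m : nat).
Local Notation C := R[i].
Local Notation Cn := 'cV[R[i]]_n.

Lemma altform_dual_ratio (g : 'M[C]_n) d e : altform (@dual_ratio R n g d e).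
Proof.
rewrite (_ : @dual_ratio R n g d e = fun w : 'I_e -> Cn => (\det g)^-1 *
    \det (\matrix_(b, a) bform (columns g)`_(d + a) (w b))).
  apply/altformZ/(altform_det (B := fun a => bform (columns g)`_(d + a))) => a.
  exact: bform_linear.
apply/funext => w; rewrite /dual_ratio -det_tr mulrC; congr (_ * \det _).
by apply/matrixP => i j; rewrite !mxE.
Qed.

(** The wedge product of the first [d] elements of the basis dual to the columns of [g]. *)
Definition coframe_form (g : 'M[C]_n) (d : nat) (u : 'I_d -> Cn) : C :=
  \det (\matrix_(b < d, a < d) bform (columns (invmx g)^T)`_a (u b)).

Lemma altform_coframe (g : 'M[C]_n) d : altform (@coframe_form g d).
Proof.
apply: (altform_det (B := fun a => bform (columns (invmx g)^T)`_a)) => a.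
exact: bform_linear.
Qed.

Lemma coframe_columns (g : 'M[C]_n) d : g \in unitmx -> (d <= n)%N ->
  coframe_form g (fun c : 'I_d => (columns g)`_c) = 1.
Proof.
move=> gu dn; rewrite -[RHS](det1 _ d); congr (\det _); apply/matrixP => b a.
rewrite !mxE (columns_nth _ (widen_ord dn a)) (columns_nth _ (widen_ord dn b)).
transitivity ((invmx g *m g) (widen_ord dn a) (widen_ord dn b)).
  by rewrite mxE; apply: eq_bigr => i _; rewrite !mxE.
by rewrite mulVmx // mxE -val_eqE eq_sym.
Qed.

Section Flag.
Variables (k : 'I_m -> nat) (x : flag R n k).

Lemma flag_dim_leq (i : 'I_m) : (k i <= n)%N.
Proof.
by rewrite -(flag_dim x) (leq_trans (dimvS (subvf _))) // dimvf /dim /= muln1.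
Qed.

Lemma in_fibre_prod (p : 'I_m -> nat)
    (G : forall i, nat -> ('I_(k i) -> subvs_of (x i)) -> C) :
  (forall i j, altform (G i j)) ->
  in_fibre p (fun v : args x => \prod_i \prod_(j < p i) G i j (v i j)).
Proof.
move=> GP; split=> [v w vw|v i j jp].
  apply: eq_bigr => i _; apply: eq_bigr => j _; congr (G i j _).
  by apply/funext => c; apply: vw.
pose c := (\prod_(j' < p i | j' != Ordinal jp) G i j' (v i j')) *
  \prod_(i' | i' != i) \prod_(j' < p i') G i' j' (v i' j').
rewrite (_ : (fun u => _) = fun u => c * G i j u); first exact: altformZ.
apply/funext => u; rewrite (bigD1 i) //= (bigD1 (Ordinal jp)) //=.
rewrite set_blockE eqxx -mulrA mulrC /c; congr (_ * _ * _).
  apply: eq_bigr => j' ne; rewrite set_blockE.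
  by rewrite -[(j' : nat) == j]/(j' == Ordinal jp) (negbTE ne).
apply: eq_bigr => i' ne; apply: eq_bigr => j' _.
by rewrite set_block_out // eq_sym.
Qed.

Lemma in_fibre_pure (p : 'I_m -> nat)
    (tau : forall i, nat -> ('I_(k i) -> Cn) -> C) :
  (forall i j, altform (tau i j)) -> in_fibre p (@pure_tensor R n m k p x tau).
Proof.
move=> tauP.
apply: (@in_fibre_prod p (fun i j u => tau i j (fun c => vsval (u c)))) => i j.
exact: (altform_comp vsval (tauP i j)).
Qed.

(** The fibre is a line: by [in_fibre_top] both functions are multiples of one product of
    determinants. The crossed form of proportionality avoids division. *)
Lemma in_fibre_line (p : 'I_m -> nat) (phi psi : args x -> C) :
  in_fibre p phi -> in_fibre p psi -> forall v w, phi v * psi w = phi w * psi v.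
Proof.
move=> hphi hpsi v w; have [e [D [_ De]]] := in_fibre_top x.
rewrite (De p phi hphi v) (De p phi hphi w) (De p psi hpsi v) (De p psi hpsi w).
by ring.
Qed.

End Flag.

Section Frame.
Variables (k : 'I_m -> nat) (x : flag R n k) (g : 'M[C]_n).
Hypotheses (gu : g \in unitmx) (xg : spanned_by x g).

Lemma vsval_frame i j c : vsval (frame x g (i := i) j c) = (columns g)`_c.
Proof.
apply: vsprojK; rewrite xg memv_span //.
rewrite -(nth_take 0 (ltn_ord c)) mem_nth // size_takel ?size_columns //.
exact: (flag_dim_leq x).
Qed.

Lemma pure_coframe_frame (p : 'I_m -> nat) :
  pure_tensor p (fun i _ => @coframe_form g (k i)) (frame x g) = 1.
Proof.
rewrite /pure_tensor big1 // => i _; rewrite big1 // => j _.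
rewrite -[RHS](coframe_columns gu (flag_dim_leq x i)); congr coframe_form.
by apply/funext => c; rewrite vsval_frame.
Qed.

(** The pure tensor of the coframe forms has value 1 at the frame, so it generates the line and the
    coefficient of [phi] is its value there. *)
Lemma in_fibre_frameE (p : 'I_m -> nat) (phi : args x -> C) : in_fibre p phi ->
  phi = fun v => phi (frame x g) * pure_tensor p (fun i _ => @coframe_form g (k i)) v.
Proof.
move=> hphi; apply/funext => v; set tau := fun i => _.
have hpsi : in_fibre p (@pure_tensor R n m k p x tau).
  by apply: in_fibre_pure => i j; apply: altform_coframe.
by rewrite -(in_fibre_line hphi hpsi v) pure_coframe_frame mulr1.
Qed.

Lemma in_fibre_frame_inj (p : 'I_m -> nat) (phi psi : args x -> C) :
  in_fibre p phi -> in_fibre p psi -> phi (frame x g) = psi (frame x g) ->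
  phi = psi.
Proof.
by move=> hphi hpsi e; rewrite (in_fibre_frameE hphi) (in_fibre_frameE hpsi) e.
Qed.

(* The value on the arguments [w] of the image of an element of the fibre whose
   value on [frame x g] is [1]. *)
Definition dual_factor l (y : flag R n l) (p : 'I_m -> nat) (w : args y) : C :=
  \prod_i \prod_(j < p (rev_ord i))
    dual_ratio g (k (rev_ord i)) (fun c => vsval (w i j c)).

Lemma in_fibre_dual_factor l (y : flag R n l) (p : 'I_m -> nat) :
  in_fibre (dual_weight p) (@dual_factor l y p).
Proof.
apply: (@in_fibre_prod l y (dual_weight p) (fun i (_ : nat) u =>
  dual_ratio g (k (rev_ord i)) (fun c => vsval (u c)))) => i _.
exact: (altform_comp vsval (altform_dual_ratio _ _ _)).
Qed.

Lemma perp_columns i (w : Cn) (c : 'I_(k i)) :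
  w \in perp (x i) -> bform (columns g)`_c w = 0.
Proof.
move=> /mem_perp; apply; rewrite -(vsval_frame 0 c); exact: subvsP.
Qed.

(** [hodge_star_ratio] applies to each factor, because the vectors of [w i] are orthogonal to
    [x (rev_ord i)]. Reindexing both products on the right undoes the reversal of the order of the
    factors. *)
Lemma pure_tensor_dual (p : 'I_m -> nat)
    (tau : forall i, nat -> ('I_(k i) -> Cn) -> C) (w : args (Psi x)) :
  (forall i j, altform (tau i j)) ->
  pure_tensor (dual_weight p) (dual_factors p tau) w =
  pure_tensor p tau (frame x g) * dual_factor p w.
Proof.
move=> tauP; rewrite /pure_tensor /dual_factor.
rewrite [X in _ = X * _](reindex_inj rev_ord_inj) -big_split /=; apply: eq_bigr => i _.
rewrite [X in _ = X * _](reindex_inj rev_ord_inj) /= -big_split /=.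
apply: eq_bigr => j _.
rewrite /dual_factors (hodge_star_ratio gu) ?(flag_dim_leq x) //; last first.
  by move=> c b; apply: perp_columns; apply: subvsP.
by congr (tau _ _ _ * _); apply/funext => c; rewrite vsval_frame.
Qed.

End Frame.

Section HatPsi.
Variables (k p : 'I_m -> nat) (x : flag R n k).

Lemma is_hatPsiE F g phi w :
  is_hatPsi p F -> g \in unitmx -> spanned_by x g -> in_fibre p phi ->
  F phi w = phi (frame x g) * dual_factor k g p w.
Proof.
move=> [Flin Fpure] gu xg hphi; set tau := fun i (_ : nat) => @coframe_form g (k i).
have tauP i j : altform (tau i j) by apply: altform_coframe.
have h0 := in_fibre0 p x; have hpure := in_fibre_pure x p tauP.
(* The linearity clause with scalar 1 and zero functions gives F 0 = F 0 + F 0. *)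
have F0 : F (fun=> 0) w = 0.
  have := Flin 1 _ _ h0 h0; rewrite (_ : (fun v => _) = fun=> 0).
    move=> /(congr1 (fun f => f w))/eqP.
    by rewrite mul1r -[X in X == _]addr0 (inj_eq (addrI _)) eq_sym => /eqP.
  by apply/funext => v; rewrite mulr0 addr0.
have -> : phi = fun v => phi (frame x g) * pure_tensor p tau v + 0.
  by rewrite {1}(in_fibre_frameE gu xg hphi); apply/funext => v; rewrite addr0.
rewrite Flin // F0 addr0 Fpure // (pure_tensor_dual gu xg) //.
by rewrite (pure_coframe_frame gu xg) mulr1 mul1r addr0.
Qed.

(** This is the well-definedness of the bundle map: the formula for one chosen frame has the
    prescribed value on every pure tensor. Hence [xget] in [hatPsi] does not return its default. *)
Lemma is_hatPsi_exists : exists F : (args x -> C) -> (args (Psi x) -> C),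
  is_hatPsi p F.
Proof.
have [g [gu xg]] := frame_exists x.
exists (fun phi w => phi (frame x g) * dual_factor k g p w); split.
  by move=> b phi psi _ _; apply/funext => w; rewrite mulrDl mulrA.
by move=> tau tauP; apply/funext => w; rewrite (pure_tensor_dual gu xg).
Qed.

Lemma hatPsiE g phi w :
  g \in unitmx -> spanned_by x g -> in_fibre p phi ->
  hatPsi p phi w = phi (frame x g) * dual_factor k g p w.
Proof.
apply: is_hatPsiE.
exact: xgetPex is_hatPsi_exists.
Qed.

End HatPsi.

(** A relation replaces [Psi] and leaves [l] free, because [dual_dims n (dual_dims n k)] equals [k]
    only propositionally. It can be read in both directions without casts. *)
Definition dual_flags (k l : 'I_m -> nat) (x : flag R n k) (y : flag R n l) :=
  forall i, x i = perp (y (rev_ord i)).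

(** The relation between [s] and its image under [tildePsi], expressed by values at frames. It can
    be iterated with [k] and [l] exchanged, and all properties of [tildePsi] are derived from it. *)
Definition dual_section k l (p : 'I_m -> nat) (s : bsection R n k)
    (sigma : bsection R n l) :=
  forall (x : flag R n k) (y : flag R n l) g (v : args y),
    dual_flags x y -> g \in unitmx -> spanned_by x g ->
    sigma y v = s x (frame x g) * dual_factor k g p v.

Lemma tildePsi_dual k (k_len : forall i, (k i <= n)%N) p (s : bsection R n k) :
  (forall x, in_fibre p (s x)) -> dual_section p s (tildePsi k_len p s).
Proof.
move=> hs x y g v xy gu xg.
have -> : x = Psi_inv k_len y by apply: flag_eq.
rewrite /tildePsi (hatPsiE _ gu) //; last first.
  by move=> i; rewrite -xg /= xy.
congr (_ * _); apply: eq_bigr => i _; apply: eq_bigr => j _.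
congr dual_ratio; apply/funext => c; rewrite vsprojK //.
by have /(congr1 (fun z : flag R n _ => z i)) -> := Psi_invK k_len y; apply: subvsP.
Qed.

End Fibres.

(** * Differentiability of determinants and adjugates *)

Section Differentiability.
Variables (K : numFieldType) (V : normedModType K).

Lemma differentiable_prod (I : Type) (s : seq I) (f : I -> V -> K^o) (x : V) :
  (forall i, differentiable (f i) x) ->
  differentiable (fun y => \prod_(i <- s) f i y : K^o) x.
Proof.
move=> df; elim: s => [|i s IH].
  rewrite (_ : (fun y => _) = cst 1); first exact: differentiable_cst.
  by apply/funext => y; rewrite big_nil.
rewrite (_ : (fun y => _) = f i * (fun y => \prod_(j <- s) f j y : K^o)).
  exact: differentiableM.
by apply/funext => y; rewrite big_cons.
Qed.

Lemma differentiable_bigsum (I : Type) (s : seq I) (W : normedModType K)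
    (f : I -> V -> W) (x : V) :
  (forall i, differentiable (f i) x) ->
  differentiable (fun y => \sum_(i <- s) f i y) x.
Proof.
move=> df; elim: s => [|i s IH].
  rewrite (_ : (fun y => _) = cst 0); first exact: differentiable_cst.
  by apply/funext => y; rewrite big_nil.
rewrite (_ : (fun y => _) = f i + (fun y => \sum_(j <- s) f j y)).
  exact: differentiableD.
by apply/funext => y; rewrite big_cons.
Qed.

Lemma differentiable_det q (A : V -> 'M[K]_q) (x : V) :
  (forall i j, differentiable (fun y => A y i j : K^o) x) ->
  differentiable (fun y => \det (A y) : K^o) x.
Proof.
move=> dA; apply: differentiable_bigsum => s.
apply: (@differentiableM _ _ (cst _) (fun y => \prod_i A y i (s i) : K^o)).
  exact: differentiable_cst.
by apply: differentiable_prod => i; apply: dA.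
Qed.

Lemma differentiable_adj q (A : V -> 'M[K]_q) (x : V) :
  (forall i j, differentiable (fun y => A y i j : K^o) x) ->
  forall i j, differentiable (fun y => (\adj (A y)) i j : K^o) x.
Proof.
move=> dA i j; rewrite (_ : (fun y => _) =
    cst ((-1) ^+ (j + i)) * (fun y => \det (row' j (col' i (A y))) : K^o)).
  apply: differentiableM; first exact: differentiable_cst.
  apply: differentiable_det => i' j'; rewrite (_ : (fun y => _) =
    fun y => A y (lift j i') (lift i j')) //.
  by apply/funext => y; rewrite !mxE.
by apply/funext => y; rewrite mxE.
Qed.

Lemma differentiable_mx p q (A : V -> 'M[K]_(p, q)) (x : V) :
  (forall i j, differentiable (fun y => A y i j : K^o) x) -> differentiable A x.
Proof.
move=> dA; rewrite (_ : A = fun y => \sum_i \sum_j A y i j *: delta_mx i j).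
  apply: differentiable_bigsum => i; apply: differentiable_bigsum => j.
  exact: differentiableZl.
by apply/funext => y; apply: matrix_sum_delta.
Qed.

End Differentiability.

(** * Dual frames and the torus action *)

Section DualFrame.
Variables (R : realType) (n m : nat).
Local Notation C := R[i].
Local Notation Cn := 'cV[R[i]]_n.

(** The sign of the reversal of [e] elements, which enters because [dual_frame] reverses the order
    of the columns. *)
Definition antidet (e : nat) : C :=
  \det (\matrix_(i < e, j < e) (rev_ord i == j)%:R).

Lemma antidet_neq0 e : antidet e != 0.
Proof.
rewrite /antidet (_ : (\matrix_(i, j) _) = perm_mx (perm rev_ord_inj)).
  by rewrite det_perm signr_eq0.
by apply/matrixP => i j; rewrite !mxE permE.
Qed.

(* The inverse transpose of [g] with its columns in reverse order: its first
   columns span the orthogonal complement of the span of the first columns of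
   [g]. *)
Definition dual_frame (g : 'M[C]_n) : 'M[C]_n :=
  \matrix_(i, j) ((\det g)^-1 * (\adj g) (rev_ord j) i).

Lemma bform_dual_frame (g : 'M[C]_n) (c d : 'I_n) : g \in unitmx ->
  bform (columns (dual_frame g))`_c (columns g)`_d = (rev_ord c == d)%:R.
Proof.
move=> gu; rewrite !columns_nth.
transitivity ((invmx g *m g) (rev_ord c) d); last by rewrite mulVmx // mxE.
by rewrite mxE; apply: eq_bigr => i _; rewrite /invmx gu !mxE.
Qed.

Lemma det_dual_frame (g : 'M[C]_n) : g \in unitmx ->
  \det (dual_frame g) * \det g = antidet n.
Proof.
move=> gu; rewrite -(det_tr (dual_frame g)) -det_mulmx; congr (\det _).
apply/matrixP => c d; rewrite !mxE -(bform_dual_frame c d gu).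
by apply: eq_bigr => i _; rewrite !columns_nth !mxE.
Qed.

Lemma det_unit_neq0 (g : 'M[C]_n) : g \in unitmx -> \det g != 0.
Proof. by rewrite unitmxE unitfE. Qed.

Lemma dual_frame_unit (g : 'M[C]_n) : g \in unitmx -> dual_frame g \in unitmx.
Proof.
move=> gu; rewrite unitmxE unitfE.
by have := antidet_neq0 n; rewrite -(det_dual_frame gu) mulf_eq0 negb_or => /andP[].
Qed.

(** The last [e] columns of [dual_frame g] are dual to the first [e] columns of [g] in reverse
    order, so the matrix of pairings is antidiagonal. *)
Lemma dual_ratio_dual_frame (g : 'M[C]_n) d e :
  g \in unitmx -> (d + e = n)%N ->
  dual_ratio (dual_frame g) d (fun b : 'I_e => (columns g)`_b) =
  antidet e / \det (dual_frame g).
Proof.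
move=> gu dn; congr (\det _ / _); apply/matrixP => a b; rewrite !mxE.
have an : (d + a < n)%N by rewrite -dn ltn_add2l.
have bn : (b < n)%N by rewrite -dn (leq_trans (ltn_ord b)) ?leq_addl.
rewrite (bform_dual_frame (Ordinal an) (Ordinal bn) gu :
  bform _`_(d + a) _`_b = _); congr (_ %:R).
by congr nat_of_bool; rewrite -!val_eqE /=; have := ltn_ord a; lia.
Qed.

Lemma dual_ratio_frame_dual (g : 'M[C]_n) d e :
  g \in unitmx -> (d + e = n)%N ->
  dual_ratio g d (fun b : 'I_e => (columns (dual_frame g))`_b) =
  antidet e / \det g.
Proof.
move=> gu dn; congr (\det _ / _); apply/matrixP => a b; rewrite !mxE.
have an : (d + a < n)%N by rewrite -dn ltn_add2l.
have bn : (b < n)%N by rewrite -dn (leq_trans (ltn_ord b)) ?leq_addl.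
rewrite bformC (bform_dual_frame (Ordinal bn) (Ordinal an) gu :
  bform _`_b _`_(d + a) = _); congr (_ %:R).
by congr nat_of_bool; rewrite -!val_eqE /=; have := ltn_ord a; have := ltn_ord b; lia.
Qed.

Lemma columns_mulmx (A g : 'M[C]_n) : columns (A *m g) = map (mulmx A) (columns g).
Proof. by rewrite -map_comp; apply: eq_map => c /=; rewrite !colE mulmxA. Qed.

Lemma columns_mulmx_nth (A g : 'M[C]_n) c :
  (columns (A *m g))`_c = A *m (columns g)`_c.
Proof.
rewrite columns_mulmx; have [cn|nc] := ltnP c n.
  by rewrite (nth_map 0) ?size_columns.
by rewrite !(nth_default 0) ?mulmx0 // -?columns_mulmx size_columns.
Qed.

Lemma torus_mxV (z : torus R n) (u : Cn) :
  torus_mx (torus_inv z) *m (torus_mx z *m u) = u.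
Proof.
by apply/colP => i; rewrite !torus_mxE /= mulrA mulVf ?mul1r ?torus_neq0.
Qed.

Lemma torus_mxK (z : torus R n) (u : Cn) :
  torus_mx z *m (torus_mx (torus_inv z) *m u) = u.
Proof.
by apply/colP => i; rewrite !torus_mxE /= mulrA mulfV ?mul1r ?torus_neq0.
Qed.

Lemma torus_bform (z : torus R n) (u v : Cn) :
  bform (torus_mx z *m u) v = bform u (torus_mx z *m v).
Proof. by apply: eq_bigr => i _; rewrite !torus_mxE mulrCA mulrA. Qed.

Lemma mem_torus_space (z : torus R n) (V : {vspace Cn}) u :
  (u \in torus_space z V) = (torus_mx (torus_inv z) *m u \in V).
Proof.
apply/memv_imgP/idP => [[v vV ->]|h]; first by rewrite lfunE /= torus_mxV.
by exists (torus_mx (torus_inv z) *m u); rewrite ?lfunE /= ?torus_mxK.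
Qed.

(** Diagonal matrices are self-adjoint for [bform], so orthogonal complements exchange the actions
    of [z] and its inverse. *)
Lemma torus_space_perp (z : torus R n) (V : {vspace Cn}) :
  torus_space z (perp V) = perp (torus_space (torus_inv z) V).
Proof.
apply/vspaceP => w; rewrite mem_torus_space; apply/idP/idP => /mem_perp h;
  apply/mem_perp => u.
  by move=> /memv_imgP[v vV ->]; rewrite lfunE /= torus_bform; apply: h.
move=> uV; rewrite -torus_bform; apply: h.
by rewrite mem_torus_space torus_mxV.
Qed.

Lemma torus_flagK (k : 'I_m -> nat) (z : torus R n) (x : flag R n k) :
  torus_flag (torus_inv z) (torus_flag z x) = x.
Proof.
apply: flag_eq => i; apply/vspaceP => u.
by rewrite /= !mem_torus_space torus_mxK.
Qed.

Lemma det_torus_mx (z : torus R n) : \det (torus_mx z) = \prod_i z i.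
Proof. by rewrite det_diag; apply: eq_bigr => i _; rewrite mxE. Qed.

Lemma torus_spanned (k : 'I_m -> nat) (z : torus R n) (x : flag R n k) (g : 'M[C]_n) :
  spanned_by x g -> spanned_by (torus_flag z x) (torus_mx z *m g).
Proof.
move=> xg i; rewrite /= xg /torus_space limg_span columns_mulmx -[in RHS]map_take.
by congr (<<_>>%VS); apply: eq_map => u; rewrite lfunE.
Qed.

(** The actions of [z] and its inverse cancel in the pairings; only the denominator [\det g]
    changes. *)
Lemma dual_ratio_torus (z : torus R n) (g : 'M[C]_n) d e (w : 'I_e -> Cn) :
  dual_ratio (torus_mx z *m g) d (fun b => torus_mx (torus_inv z) *m w b) =
  dual_ratio g d w / \det (torus_mx z).
Proof.
rewrite /dual_ratio det_mulmx invfM -mulrA [_^-1 * _]mulrC.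
congr (\det _ * _); apply/matrixP => a b; rewrite !mxE.
by rewrite columns_mulmx_nth torus_bform torus_mxK.
Qed.

End DualFrame.

(** * Dual sections *)

Section DualSections.
Variables (R : realType) (n m : nat).
Local Notation C := R[i].
Local Notation Cn := 'cV[R[i]]_n.

Section Pair.
Variables k l : 'I_m -> nat.
Hypothesis kl : forall i, (k i + l (rev_ord i))%N = n.

Lemma kl_sym i : (l i + k (rev_ord i))%N = n.
Proof. by rewrite addnC -{2}(rev_ordK i) kl. Qed.

Lemma dual_flag_exists (y : flag R n l) : exists x : flag R n k, dual_flags x y.
Proof.
have d i : \dim (perp (y (rev_ord i))) = k i.
  by rewrite dim_perp flag_dim -(kl i) addnK.
have s (i j : 'I_m) : (i <= j)%N ->
    (perp (y (rev_ord i)) <= perp (y (rev_ord j)))%VS.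
  by move=> ij; apply/perpS/flag_incl/rev_ord_le.
by exists (Flag d s).
Qed.

Lemma dual_flags_sym (x : flag R n k) (y : flag R n l) :
  dual_flags x y -> dual_flags y x.
Proof. by move=> xy i; rewrite xy perpK rev_ordK. Qed.

(** By dimension an inclusion suffices. Column [c] of the dual frame pairs nontrivially only with
    column [n - 1 - c] of [g], which for [c < k i] is not among the first [l (rev_ord i)]
    columns. *)
Lemma dual_frame_spanned (x : flag R n k) (y : flag R n l) (g : 'M[C]_n) :
  dual_flags x y -> g \in unitmx -> spanned_by y g ->
  spanned_by x (dual_frame g).
Proof.
move=> xy gu yg i; apply/esym/eqP; have gu' := dual_frame_unit gu.
have szk : (k i <= n)%N by rewrite -(kl i) leq_addr.
rewrite eqEdim; apply/andP; split; last first.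
  have : free (take (k i) (columns (dual_frame g))).
    apply: (@catl_free _ _ (drop (k i) (columns (dual_frame g)))).
    by rewrite cat_take_drop free_columns.
  by rewrite flag_dim => /eqP ->; rewrite size_takel ?size_columns.
apply/span_subvP => u /(nthP 0)[c]; rewrite size_takel ?size_columns // => ck <-.
rewrite nth_take // xy; apply/mem_perp => w; rewrite yg => wy.
have cn : (c < n)%N by apply: leq_trans ck szk.
(* Stated as membership in a subspace, orthogonality need only be checked on the columns that span
   [y (rev_ord i)]. *)
suff : w \in perp <[(columns (dual_frame g))`_c]>%VS.
  by move=> /mem_perp h; rewrite bformC h // memv_line.
apply: subvP wy; apply/span_subvP => v /(nthP 0)[d].
have szl : (l (rev_ord i) <= n)%N by rewrite -(kl i) leq_addl.
rewrite size_takel ?size_columns // => dl <-; rewrite nth_take //.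
apply/mem_perp => _ /vlineP[a ->].
have dn : (d < n)%N by apply: leq_trans dl szl.
rewrite bformZl (bform_dual_frame (Ordinal cn) (Ordinal dn) gu :
  bform _`_c _`_d = _) -val_eqE /= (_ : _ == _ = false) ?mulr0 //.
by apply/negbTE; move: dl ck; rewrite -(kl i); lia.
Qed.

Variable p : 'I_m -> nat.

Section Dual.
Variables (s : bsection R n k) (sigma : bsection R n l).
Arguments s : clear implicits.
Arguments sigma : clear implicits.
Hypothesis ss : dual_section p s sigma.

Lemma dual_section_fibre y : in_fibre (dual_weight p) (sigma y).
Proof.
have [x xy] := dual_flag_exists y; have [g [gu xg]] := frame_exists x.
rewrite (_ : sigma y = fun v => s x (frame x g) * dual_factor k g p v).
  exact/in_fibreZ/in_fibre_dual_factor.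
by apply/funext => v; rewrite (ss _ xy gu xg).
Qed.

(** A frame [g] of [y] gives the frame [dual_frame g] of [x], for which each dual ratio is a sign
    divided by a determinant. *)
Lemma dual_section_frame (x : flag R n k) (y : flag R n l) (g : 'M[C]_n) :
  dual_flags x y -> g \in unitmx -> spanned_by y g ->
  sigma y (frame y g) = s x (frame x (dual_frame g)) *
    \prod_i \prod_(j < p (rev_ord i)) (antidet R (l i) / \det (dual_frame g)).
Proof.
move=> xy gu yg.
rewrite (ss _ xy (dual_frame_unit gu) (dual_frame_spanned xy gu yg)).
congr (_ * _); apply: eq_bigr => i _; apply: eq_bigr => j _.
rewrite -(dual_ratio_dual_frame gu (d := k (rev_ord i))); last first.
  by rewrite addnC kl_sym.
by congr dual_ratio; apply/funext => c; rewrite (vsval_frame yg).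
Qed.

Lemma dual_section_holomorphic : holomorphic s -> holomorphic sigma.
Proof.
move=> [f [fd fE]].
(* The right-hand side of [dual_section_frame], with the inverse of [\det (dual_frame g)] written as
   [\det g / antidet R n]. *)
exists (fun g => f (dual_frame g) *
  \prod_i \prod_(j < p (rev_ord i)) (antidet R (l i) / antidet R n * \det g)).
split=> [g gu|g y gu yg].
  have dcoord i j :
      differentiable (fun h : ('M[C]_n : normedModType C) => h i j : C^o) g.
    exact: differentiable_coord.
  apply: (@differentiableM _ _ (fun g => f (dual_frame g))
    (fun g => \prod_i \prod_(j < p (rev_ord i))
      (antidet R (l i) / antidet R n * \det g) : C^o)).
    apply: differentiable_comp; last exact/fd/dual_frame_unit.
    (* The entries of [dual_frame] are entries of the adjugate divided by the determinant. *)
    apply: differentiable_mx => i j; rewrite (_ : (fun y => _) =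
      (fun h : ('M[C]_n : normedModType C) => (\det h)^-1 : C^o) *
      (fun h : ('M[C]_n : normedModType C) => (\adj h) (rev_ord j) i : C^o)); last first.
      by apply/funext => h; rewrite mxE.
    apply: differentiableM; last exact: differentiable_adj.
    by apply: differentiableV; [exact: differentiable_det|exact: det_unit_neq0].
  apply: differentiable_prod => i; apply: differentiable_prod => j.
  apply: (@differentiableM _ _ (cst _) (fun g => \det g : C^o)).
    exact: differentiable_cst.
  exact: differentiable_det.
have [x xy] := dual_flag_exists y.
rewrite (dual_section_frame xy gu yg).
rewrite (fE _ _ (dual_frame_unit gu) (dual_frame_spanned xy gu yg)).
congr (_ * _); apply: eq_bigr => i _; apply: eq_bigr => j _.
rewrite -mulrA; congr (_ * _); rewrite -(det_dual_frame gu) invfM -mulrA.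
by rewrite mulVf ?mulr1 // det_unit_neq0.
Qed.

(** The flag [torus_flag (torus_inv z) y] is dual to [torus_flag z x], which is framed by
    [torus_mx z *m g]. There [s] contributes the character [t], and each of the [\sum_j p j] dual
    ratios contributes the inverse of det z; together with the character [t'] these cancel. *)
Lemma dual_section_torus t t' :
  (forall i, t i + t' i = (\sum_j p j)%N%:Z) ->
  (forall z, torus_act t z s = s) -> forall z, torus_act t' z sigma = sigma.
Proof.
move=> tt' st z; apply: functional_extensionality_dep => y; apply/funext => v.
have [x xy] := dual_flag_exists y; have [g [gu xg]] := frame_exists x.
have zu : torus_mx z \in unitmx.
  rewrite unitmxE unitfE det_torus_mx; apply/prodf_neq0 => i _.
  exact: torus_neq0.
have zxy : dual_flags (torus_flag z x) (torus_flag (torus_inv z) y).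
  by move=> i; rewrite /= xy torus_space_perp.
have zgu : torus_mx z *m g \in unitmx by rewrite unitmx_mul zu.
have zxg := torus_spanned z xg.
rewrite /torus_act (ss _ zxy zgu zxg) (ss _ xy gu xg).
have -> : s (torus_flag z x) (frame (torus_flag z x) (torus_mx z *m g)) =
    torus_char t z * s x (frame x g).
  rewrite -{1}(st z) /torus_act; congr (_ * _).
  (* Moving by [z] and back returns [x] only up to a propositional equality, so the flag is
     generalized before substitution. *)
  have E (x' : flag R n k) (u : args x') : x' = x ->
      (forall i j c, vsval (u i j c) = (columns g)`_c) -> s x' u = s x (frame x g).
    move=> e; subst x' => uE; congr (s x _); apply: args_eq => i j.
    by apply/funext => c; apply: val_inj; rewrite /= (vsval_frame xg) uE.
  apply: E (torus_flagK z x) _ => i j c.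
  rewrite (vsval_frame zxg) columns_mulmx_nth torus_mxV vsprojK //.
  by rewrite torus_flagK -(vsval_frame xg 0 c); apply: subvsP.
have -> : dual_factor k (torus_mx z *m g) p
    (fun (i : 'I_m) (j : nat) (c : 'I_(l i)) =>
       vsproj (torus_flag (torus_inv z) y i)
         (torus_mx (torus_inv z) *m vsval (v i j c))) =
    dual_factor k g p v / \det (torus_mx z) ^+ (\sum_j p j)%N.
  rewrite -exprVn -prodrXr (reindex_inj rev_ord_inj) /= -big_split /=.
  apply: eq_bigr => i _; rewrite -[X in _ ^+ X]card_ord -prodr_const -big_split /=.
  apply: eq_bigr => j _; rewrite -dual_ratio_torus; congr dual_ratio.
  apply/funext => c; rewrite vsprojK // mem_torus_space torus_mxV.
  exact: subvsP.
have E : torus_char t' z * torus_char t z = \det (torus_mx z) ^+ (\sum_j p j)%N.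
  rewrite mulrC -torus_charD /torus_char det_torus_mx -prodrXl.
  by apply: eq_bigr => i _; rewrite tt'.
rewrite !mulrA E mulrAC; set d := _ ^+ _.
have d0 : d != 0 by rewrite expf_neq0 // det_unit_neq0.
by rewrite -!mulrA mulrCA; field.
Qed.

Lemma dual_section_inv t t' :
  (forall i, t i + t' i = (\sum_j p j)%N%:Z) ->
  inv_section p t s -> inv_section (dual_weight p) t' sigma.
Proof.
move=> tt' [_ sh st]; split; first exact: dual_section_fibre.
  exact: dual_section_holomorphic.
exact: dual_section_torus tt' st.
Qed.

End Dual.
End Pair.
End DualSections.

(** * Compatibility of duality with sums and tensor products, and biduality *)

Section DualSectionAlgebra.
Variables (R : realType) (n m : nat).
Local Notation C := R[i].
Variables k l : 'I_m -> nat.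
Hypothesis kl : forall i, (k i + l (rev_ord i))%N = n.
Implicit Types (p q : 'I_m -> nat) (s : bsection R n k) (sigma : bsection R n l).

Lemma dual_section_uniq p s sigma sigma' :
  dual_section p s sigma -> dual_section p s sigma' -> sigma = sigma'.
Proof.
move=> ss ss'; apply: functional_extensionality_dep => y; apply/funext => v.
have [x xy] := dual_flag_exists kl y; have [g [gu xg]] := frame_exists x.
by rewrite (ss _ _ _ _ xy gu xg) (ss' _ _ _ _ xy gu xg).
Qed.

Lemma dual_section0 p :
  dual_section p (fun (x : flag R n k) _ => 0) (fun (y : flag R n l) _ => 0).
Proof. by move=> x y g v _ _ _; rewrite mul0r. Qed.

Lemma dual_section_lin p (c : C) s s' sigma sigma' :
  dual_section p s sigma -> dual_section p s' sigma' ->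
  dual_section p (fun x v => s x v + c * s' x v)
    (fun y v => sigma y v + c * sigma' y v).
Proof.
move=> ss ss' x y g v xy gu xg.
by rewrite (ss _ _ _ _ xy gu xg) (ss' _ _ _ _ xy gu xg) mulrDl mulrA.
Qed.

Lemma dual_section_sum p d (s : 'I_d -> bsection R n k)
    (sigma : 'I_d -> bsection R n l) :
  (forall i, dual_section p (s i) (sigma i)) ->
  dual_section p (fun x v => \sum_i s i x v) (fun y v => \sum_i sigma i y v).
Proof.
move=> ss x y g v xy gu xg; rewrite mulr_suml; apply: eq_bigr => i _.
by rewrite (ss i _ _ _ _ xy gu xg).
Qed.

Lemma dual_section_const (c : C) :
  dual_section (fun=> 0%N) (fun (x : flag R n k) _ => c)
    (fun (y : flag R n l) _ => c).
Proof.
move=> x y g v _ _ _; rewrite /dual_factor big1 ?mulr1 // => i _.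
by rewrite big_ord0.
Qed.

(** [dual_factor] is a product over the tensor factors, and its ratio depends on the index [i] but
    not on the position [j]. It therefore splits, even though [hatPsi] reverses the order of the
    factors. *)
Lemma dual_section_tensor p q s s' sigma sigma' :
  dual_section p s sigma -> dual_section q s' sigma' ->
  dual_section (fun i => p i + q i)%N (fun x => tensor p (s x) (s' x))
    (fun y => tensor (dual_weight p) (sigma y) (sigma' y)).
Proof.
move=> ss ss' x y g v xy gu xg; rewrite /tensor.
rewrite (ss _ _ _ _ xy gu xg) (ss' _ _ _ _ xy gu xg) mulrACA; congr (_ * _).
rewrite -big_split /=; apply: eq_bigr => i _.
by rewrite big_split_ord /=.
Qed.

Lemma dual_section_exists p s : (forall x, in_fibre p (s x)) ->
  exists sigma : bsection R n l, dual_section p s sigma.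
Proof.
move=> hs; have el : l = dual_dims n k.
  by apply/funext => i; rewrite /dual_dims -(kl (rev_ord i)) rev_ordK addKn.
have k_len i : (k i <= n)%N by rewrite -(kl i) leq_addr.
by subst l; exists (tildePsi k_len p s); apply: tildePsi_dual.
Qed.

(** The scalar by which applying the duality twice multiplies a section of weight [p]. The
    determinants of the two frames have combined into [antidet R n]. *)
Definition bidual_factor p : C :=
  (\prod_i \prod_(j < p (rev_ord i)) (antidet R (l i) / antidet R n)) *
  \prod_i \prod_(j < p i) antidet R (k i).

Lemma bidual_factor_neq0 p : bidual_factor p != 0.
Proof.
rewrite mulf_neq0 //; apply/prodf_neq0 => i _; apply/prodf_neq0 => j _;
  by rewrite ?mulf_neq0 ?invr_eq0 ?antidet_neq0.
Qed.

(** Both sides lie in the fibre at [x], so one frame suffices. With [h] a frame of the dual flag,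
    [dual_frame h] is a frame of [x] that makes the dual ratios of both steps explicit. *)
Lemma bidual_section p s sigma (s' : bsection R n k) :
  (forall x, in_fibre p (s x)) ->
  dual_section p s sigma -> dual_section (dual_weight p) sigma s' ->
  s' = fun x v => bidual_factor p * s x v.
Proof.
move=> hs ss ss'; have lk := kl_sym kl.
have pK : dual_weight (dual_weight p) = p.
  by apply/funext => i; rewrite /dual_weight rev_ordK.
have hs' x : in_fibre p (s' x).
  by rewrite -pK; apply: (dual_section_fibre lk ss').
apply: functional_extensionality_dep => x.
have [y yx] := dual_flag_exists lk x; have xy := dual_flags_sym yx.
have [h [hu yh]] := frame_exists y.
have gu := dual_frame_unit hu; have xg := dual_frame_spanned kl xy hu yh.
apply: (in_fibre_frame_inj gu xg (hs' x) (in_fibreZ _ (hs x))) => /=.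
rewrite (ss' _ _ _ _ yx hu yh) (dual_section_frame kl ss xy hu yh).
rewrite -mulrA [RHS]mulrC; congr (_ * _).
have -> : dual_factor l h (dual_weight p) (frame x (dual_frame h)) =
    \prod_i \prod_(j < p i) (antidet R (k i) / \det h).
  apply: eq_bigr => i _; rewrite /dual_weight rev_ordK.
  apply: eq_bigr => j _; rewrite -(dual_ratio_frame_dual hu (d := l (rev_ord i))).
    by congr dual_ratio; apply/funext => c; rewrite (vsval_frame xg).
  by rewrite addnC kl.
rewrite /bidual_factor (reindex_inj rev_ord_inj) /=.
rewrite [X in _ = X * _](reindex_inj rev_ord_inj) /= -!big_split /=.
apply: eq_bigr => i _; rewrite rev_ordK -!big_split /=; apply: eq_bigr => j _.
rewrite -(det_dual_frame hu).
have d1 := det_unit_neq0 hu; have d2 := det_unit_neq0 gu.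
by field; rewrite d1 d2.
Qed.

End DualSectionAlgebra.

(** * The isomorphism of the graded rings of invariant sections *)

Section DualRing.
Variables (R : realType) (n m : nat) (k a : 'I_m -> nat) (r s : 'I_n -> int).
Local Notation C := R[i].
Local Notation l := (dual_dims n k).
Local Notation b := (dual_weight a).
Hypothesis k_len : forall i, (k i <= n)%N.
Hypothesis rs : forall i, r i + s i = (\sum_j a j)%N%:Z.

Let T N := tildePsi (R := R) k_len (power a N).

Lemma dual_dims_sum i : (k i + l (rev_ord i))%N = n.
Proof. by rewrite /dual_dims rev_ordK subnKC. Qed.
Let kl := dual_dims_sum.

Lemma power_char_sum N i :
  power_char r N i + power_char s N i = (\sum_j power a N j)%N%:Z.
Proof. by rewrite /power_char -mulrDr rs -big_distrr. Qed.

Lemma power_char_sum_sym N i :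
  power_char s N i + power_char r N i = (\sum_j power b N j)%N%:Z.
Proof.
rewrite addrC power_char_sum; congr Posz.
by rewrite (reindex_inj rev_ord_inj).
Qed.

Lemma inv_tildePsi_dual N (f : bsection R n k) :
  inv_section (power a N) (power_char r N) f -> dual_section (power a N) f (T N f).
Proof. by case=> hf _ _; apply: tildePsi_dual. Qed.

Lemma inv_tildePsi N (f : bsection R n k) :
  inv_section (power a N) (power_char r N) f ->
  inv_section (power b N) (power_char s N) (T N f).
Proof.
move=> hf; apply: (dual_section_inv kl (inv_tildePsi_dual hf) _ hf) => i.
exact: power_char_sum.
Qed.

Lemma tildePsi0 N : T N (fun x _ => 0) = fun x _ => 0.
Proof.
apply: (dual_section_uniq kl _ (dual_section0 _)).
apply: inv_tildePsi_dual; exact: inv_section0.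
Qed.

(** A dual [h] of the common image is, by biduality, the same nonzero multiple of [f] and of [g]. *)
Lemma tildePsi_inj N (f g : bsection R n k) :
  inv_section (power a N) (power_char r N) f ->
  inv_section (power a N) (power_char r N) g -> T N f = T N g -> f = g.
Proof.
move=> hf hg fg; have hTf := inv_tildePsi hf.
have [h hh] := dual_section_exists (kl_sym kl) (let: And3 H _ _ := hTf in H).
have ef := bidual_section kl (let: And3 H _ _ := hf in H) (inv_tildePsi_dual hf) hh.
rewrite fg in hh.
have eg := bidual_section kl (let: And3 H _ _ := hg in H) (inv_tildePsi_dual hg) hh.
apply: functional_extensionality_dep => x; apply/funext => v.
apply: (mulfI (bidual_factor_neq0 R n k l (power a N))).
by have := congr1 (fun F : bsection R n k => F x v) eg; rewrite /= ef.
Qed.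

Lemma tildePsi_surj N (f : bsection R n l) :
  inv_section (power b N) (power_char s N) f ->
  exists2 g, inv_section (power a N) (power_char r N) g & T N g = f.
Proof.
move=> hf; have lk := kl_sym kl.
have [h hh] := dual_section_exists lk (let: And3 H _ _ := hf in H).
have bK : dual_weight (power b N) = power a N.
  by apply/funext => i; rewrite /dual_weight /power /dual_weight rev_ordK.
have hinv := dual_section_inv lk hh (power_char_sum_sym N) hf.
rewrite bK in hinv.
set K := bidual_factor R n l k (power b N).
have K0 : K != 0 by apply: bidual_factor_neq0.
have hK := inv_sectionZ K^-1 hinv.
(* The dual [h] of [f] has dual [K] times [f], so the preimage is [h] divided by [K]. *)
exists (fun x v => K^-1 * h x v) => //.
have := bidual_section lk (let: And3 H _ _ := hf in H) hh.
rewrite bK => /(_ _ (inv_tildePsi_dual hinv)) e.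
apply: (dual_section_uniq kl (inv_tildePsi_dual hK)) => x y g v xy gu xg.
rewrite -mulrA -(inv_tildePsi_dual hinv v xy gu xg) e.
by rewrite mulKf.
Qed.

Lemma dual_ring_fin (f : inv_ring R k a r) : exists d, forall N, (d <= N)%N ->
  T N (f N) = fun x _ => 0.
Proof.
by have [d df] := inv_component_fin f; exists d => N /df ->; apply: tildePsi0.
Qed.

Definition dual_ring (f : inv_ring R k a r) : inv_ring R l b s :=
  InvRing (fun N => inv_tildePsi (inv_componentP f N)) (dual_ring_fin f).

(** A dual section is unique, so identities in the target ring reduce to the relation [dual_section]
    in each degree. *)
Lemma dual_ring_eq (f : inv_ring R k a r) (g : inv_ring R l b s) :
  (forall N, dual_section (power a N) (f N) (g N)) -> dual_ring f = g.
Proof.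
move=> h; apply: inv_ring_eq => N x v; congr (_ x v).
exact: (dual_section_uniq kl (inv_tildePsi_dual (inv_componentP f N)) (h N)).
Qed.

Let dual_ring_dual (f : inv_ring R k a r) N :
  dual_section (power a N) (f N) (dual_ring f N) :=
  inv_tildePsi_dual (inv_componentP f N).

Lemma dual_ringB : zmod_morphism dual_ring.
Proof. by move=> f g; apply: dual_ring_eq => N; apply: dual_section_lin. Qed.

Lemma dual_ring_const c : dual_ring (inv_const k a r c) = inv_const l b s c.
Proof.
apply: dual_ring_eq => -[|N] /=; last exact: dual_section0.
exact: dual_section_const.
Qed.

Lemma dual_ringM : monoid_morphism dual_ring.
Proof.
split=> [|f g]; first exact: dual_ring_const.
apply: dual_ring_eq => N; apply: dual_section_sum => i.
have -> : power a N = (fun j => power a i j + power a (N - i) j)%N.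
  by apply/funext => j; rewrite /power -mulnDl subnKC // -ltnS.
exact: (dual_section_tensor (dual_ring_dual f i) (dual_ring_dual g (N - i)%N)).
Qed.

Lemma dual_ring_inj : injective dual_ring.
Proof.
move=> f g fg; apply: inv_ring_eq => N x v; congr (_ x v).
apply: (tildePsi_inj (inv_componentP f N) (inv_componentP g N)).
exact: (congr1 (fun h : inv_ring R l b s => h N) fg).
Qed.

Lemma dual_ring_surj g : exists f, dual_ring f = g.
Proof.
have /choice[h hh] : forall N, exists f : bsection R n k,
    inv_section (power a N) (power_char r N) f /\ T N f = g N.
  move=> N; have [f fP fg] := tildePsi_surj (inv_componentP g N).
  by exists f.
(* The preimages are chosen degree by degree; where [g] vanishes, injectivity forces them to vanish,
   so they form an element of the direct sum. *)
have hfin : exists d, forall N, (d <= N)%N -> h N = fun x _ => 0.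
  have [d gd] := inv_component_fin g; exists d => N /gd gN.
  apply: (tildePsi_inj (hh N).1 (inv_section0 R k _ _)).
  by rewrite (hh N).2 gN tildePsi0.
exists (InvRing (fun N => (hh N).1) hfin); apply: inv_ring_eq => N x v.
by rewrite -(hh N).2.
Qed.

Lemma dual_ring_piece N f : inv_piece N f <-> inv_piece N (dual_ring f).
Proof.
split=> h M MN; first by rewrite /= h // tildePsi0.
apply: (tildePsi_inj (inv_componentP f M) (inv_section0 R k _ _)).
by rewrite tildePsi0; apply: h.
Qed.

Lemma dual_ring_bij : bijective dual_ring.
Proof.
have /choice[inv invK] := dual_ring_surj; exists inv => // f.
exact/dual_ring_inj/invK.
Qed.

Lemma dual_graded_iso : exists Phi : graded_iso (inv_alg R k a r) (inv_alg R l b s),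
  forall (f : inv_ring R k a r) N, inv_component (Phi f) N = T N (f N).
Proof.
pose phi := HB.pack_for {rmorphism inv_ring R k a r -> inv_ring R l b s} dual_ring
  (GRing.isZmodMorphism.Build _ _ dual_ring dual_ringB)
  (GRing.isMonoidMorphism.Build _ _ dual_ring dual_ringM).
by exists (@GradedIso _ (inv_alg R k a r) (inv_alg R l b s) phi dual_ring_bij
  dual_ring_const dual_ring_piece).
Qed.

End DualRing.

Theorem theorem1p10 (R : realType) (n m : nat) (k a : 'I_m -> nat)
    (r : 'I_n -> int)
    (m_gt0 : (0 < m)%N)
    (k_gt0 : forall i, (0 < k i)%N)
    (k_incr : forall i j : 'I_m, (i < j)%N -> (k i < k j)%N)
    (k_ltn : forall i, (k i < n)%N)
    (a_gt0 : forall i, (0 < a i)%N)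
    (r_gt0 : forall i, 0 < r i)
    (r_sum : \sum_i r i = (\sum_i a i * k i)%N%:Z) :
  let l := dual_dims n k in
  let b := dual_weight a in
  let s := fun i => (\sum_j a j)%N%:Z - r i in
  exists Phi : graded_iso (inv_alg R k a r) (inv_alg R l b s),
    (forall (f : inv_ring R k a r) (N : nat),
       inv_component (Phi f) N =
       tildePsi (fun i => ltnW (k_ltn i)) (power a N) (inv_component f N)) /\
    exists F : ringed_iso (mumford_quotient R k a r) (mumford_quotient R l b s),
      induced_by Phi F.
Proof.
move=> l b s; have rs i : r i + s i = (\sum_j a j)%N%:Z by rewrite addrC subrK.
have [Phi PhiE] := dual_graded_iso R (fun i => ltnW (k_ltn i)) rs.
by exists Phi; split; [exact: PhiE|exact: Proj_iso].
Qed.
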